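(* Let $\Gamma$ be a finite simplicial graph, let $G_\Gamma$ be the associated right-angled Coxeter group and let $H$ be a parabolic subgroup of $G_\Gamma$. Then $H$ is strongly quasiconvex in $G_\Gamma$ if and only if $H$ has finite height in $G_\Gamma$.
   Context: Right-angled Coxeter group: for a finite simplicial graph $\Gamma$ with vertex set $S$, $G_\Gamma$ is generated by $S$ with relations $s^2=1$ for $s\in S$ and $st=ts$ for adjacent $s,t$. A special subgroup is a subgroup generated by a subset of $S$; a parabolic subgroup is a conjugate of a special subgroup. Height: the height of a subgroup $H$ of a group $G$ is the smallest number $n$ with the property that for any $n+1$ distinct left cosets $g_1H,\dots,g_{n+1}H$ the intersection $\bigcap_i g_iHg_i^{-1}$ is finite. $H$ has finite height in $G$ if such an $n$ exists. A $(K,C)$-quasi-geodesic in a metric space $Y$ is a map $f\colon I\to Y$ from a subinterval $I$ of $\mathbb{R}$ or $\mathbb{Z}$ with $\frac1K|s-t|-C\le d(f(s),f(t))\le K|s-t|+C$ for all $s,t\in I$; quasi-geodesics in a finitely generated group are taken in a Cayley graph for a finite generating set. A subgroup $H$ of a finitely generated group $G$ is strongly quasiconvex if for every $K\ge1$, $C\ge0$ there is $M=M(K,C)$ such that every $(K,C)$-quasi-geodesic in $G$ with endpoints on $H$ is contained in the $M$-neighborhood of $H$. *)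

(* Defs.v *)
From HB Require Import structures.
From mathcomp Require Import all_boot all_order all_algebra.
From mathcomp Require Import boolp classical_sets functions cardinality.
From mathcomp Require Import set_interval reals.

Set Implicit Arguments.
Unset Strict Implicit.
Unset Printing Implicit Defensive.

Import Order.TTheory GRing.Theory Num.Theory.

Local Open Scope classical_set_scope.
Local Open Scope group_scope.

Section Presentation.
Variable X : choiceType.

(* The letter (x, true) stands for x and (x, false) for its inverse. *)
Definition letter := (X * bool)%type.

Definition inv_letter (a : letter) : letter := (a.1, ~~ a.2).

Definition inv_word (w : seq letter) : seq letter := rev (map inv_letter w).

(* [r u v] is the defining relation u = v. *)
Variable r : seq letter -> seq letter -> Prop.

Inductive word_eq : seq letter -> seq letter -> Prop :=
| word_eq_refl w : word_eq w w
| word_eq_sym u v : word_eq u v -> word_eq v u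
| word_eq_trans u v w : word_eq u v -> word_eq v w -> word_eq u w
| word_eq_cancel p q a : word_eq (p ++ [:: a; inv_letter a] ++ q) (p ++ q)
| word_eq_rel p q u v : r u v -> word_eq (p ++ u ++ q) (p ++ v ++ q).

Definition word_eqb (u v : seq letter) : bool := `[< word_eq u v >].

Lemma word_eqb_refl : reflexive word_eqb.
Proof. by move=> w; apply/asboolP; apply: word_eq_refl. Qed.

Lemma word_eqb_sym : symmetric word_eqb.
Proof. by move=> u v; apply/asboolP/asboolP; apply: word_eq_sym. Qed.

Lemma word_eqb_trans : transitive word_eqb.
Proof.
by move=> v u w /asboolP uv /asboolP vw; apply/asboolP; apply: word_eq_trans vw.
Qed.

Canonical word_eqb_equiv :=
  EquivRel word_eqb word_eqb_refl word_eqb_sym word_eqb_trans.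

Definition presented_group : Type := {eq_quot word_eqb}%qT.

HB.instance Definition _ := Choice.on presented_group.

Definition word_class (w : seq letter) : presented_group :=
  (\pi_({eq_quot word_eqb}) w)%qT.

Definition word_repr (g : presented_group) : seq letter :=
  repr (g : {eq_quot word_eqb}%qT).

Lemma word_reprK : cancel word_repr word_class.
Proof. by move=> g; apply: reprK. Qed.

Lemma word_classP u v : word_class u = word_class v <-> word_eq u v.
Proof.
split=> [/(@eqmodP _ word_eqb_equiv) /asboolP //|uv].
by apply/(@eqmodP _ word_eqb_equiv)/asboolP.
Qed.

Lemma word_repr_class w : word_eq (word_repr (word_class w)) w.
Proof. by apply/word_classP; rewrite word_reprK. Qed.

Lemma word_eq_ctx p q u v : word_eq u v -> word_eq (p ++ u ++ q) (p ++ v ++ q).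
Proof.
elim=> [w|u' v' _|u' v' w _ uv _|p' q' a|p' q' u' v' ruv].
- exact: word_eq_refl.
- exact: word_eq_sym.
- exact: word_eq_trans.
- have := word_eq_cancel (p ++ p') (q' ++ q) a.
  by rewrite !catA -!(catA _ q' q) !catA.
- have := word_eq_rel (p ++ p') (q' ++ q) ruv.
  by rewrite !catA.
Qed.

Lemma word_eq_cat u u' v v' :
  word_eq u u' -> word_eq v v' -> word_eq (u ++ v) (u' ++ v').
Proof.
move=> uu' vv'; apply: (@word_eq_trans _ (u' ++ v)).
  exact: (word_eq_ctx [::] v uu').
by have := word_eq_ctx u' [::] vv'; rewrite !cats0.
Qed.

Lemma inv_letterK : involutive inv_letter.
Proof. by case=> x b; rewrite /inv_letter /= negbK. Qed.

Lemma inv_wordK : involutive inv_word.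
Proof. by move=> w; rewrite /inv_word map_rev revK mapK //; exact: inv_letterK. Qed.

Lemma word_eqwV w : word_eq (w ++ inv_word w) [::].
Proof.
elim: w => [|a w IHw]; first exact: word_eq_refl.
apply: word_eq_trans (word_eq_cancel [::] [::] a).
rewrite /inv_word /= rev_cons -cats1 -/(inv_word w).
by have := word_eq_ctx [:: a] [:: inv_letter a] IHw; rewrite -!catA.
Qed.

Lemma word_eqVw w : word_eq (inv_word w ++ w) [::].
Proof. by have := word_eqwV (inv_word w); rewrite inv_wordK. Qed.

Definition pres_one : presented_group := word_class [::].

Definition pres_mul (g h : presented_group) : presented_group :=
  word_class (word_repr g ++ word_repr h).

Definition pres_inv (g : presented_group) : presented_group :=
  word_class (inv_word (word_repr g)).

Lemma pres_mulE u v : pres_mul (word_class u) (word_class v) = word_class (u ++ v).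
Proof. by apply/word_classP; apply: word_eq_cat; apply: word_repr_class. Qed.

Lemma pres_mulA : associative pres_mul.
Proof.
move=> g h k; rewrite -(word_reprK g) -(word_reprK h) -(word_reprK k).
by rewrite !pres_mulE catA.
Qed.

Lemma pres_mul1g : left_id pres_one pres_mul.
Proof. by move=> g; rewrite -(word_reprK g) pres_mulE. Qed.

Lemma pres_mulg1 : right_id pres_one pres_mul.
Proof. by move=> g; rewrite -(word_reprK g) pres_mulE cats0. Qed.

Lemma pres_mulVg : left_inverse pres_one pres_inv pres_mul.
Proof.
move=> g; rewrite -{2}(word_reprK g) pres_mulE.
by apply/word_classP; apply: word_eqVw.
Qed.

Lemma pres_mulgV : right_inverse pres_one pres_inv pres_mul.
Proof.
move=> g; rewrite -{1}(word_reprK g) pres_mulE.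
by apply/word_classP; apply: word_eqwV.
Qed.

HB.instance Definition _ := isGroup.Build presented_group
  pres_mulA pres_mul1g pres_mulg1 pres_mulVg pres_mulgV.

End Presentation.

Section RightAngledCoxeter.
Variables (V : finType) (adj : rel V).

Inductive racg_rel : seq (letter V) -> seq (letter V) -> Prop :=
| racg_square s : racg_rel [:: (s, true); (s, true)] [::]
| racg_commute s t : adj s t ->
    racg_rel [:: (s, true); (t, true)] [:: (t, true); (s, true)].

Definition racg : Type := presented_group racg_rel.

HB.instance Definition _ := Group.on racg.

Definition racg_gen (s : V) : racg := word_class racg_rel [:: (s, true)].

End RightAngledCoxeter.

Section Subgroups.
Variable G : groupType.
Implicit Types (A H : set G) (g : G).

Definition is_subgroup H : Prop :=
  [/\ H 1, forall x y, H x -> H y -> H (x * y) & forall x, H x -> H x^-1].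

Definition generated A : set G := smallest is_subgroup A.

Definition left_coset g H : set G := [set g * h | h in H].

Definition conj_set g H : set G := [set g * h * g^-1 | h in H].

Definition height_bound H (n : nat) : Prop :=
  forall g : 'I_n.+1 -> G,
    (forall i j, i != j -> left_coset (g i) H <> left_coset (g j) H) ->
    finite_set (\bigcap_(i in [set: 'I_n.+1]) conj_set (g i) H).

Definition is_height H (n : nat) : Prop :=
  height_bound H n /\ forall m, height_bound H m -> (n <= m)%N.

Definition finite_height H : Prop := exists n, is_height H n.

End Subgroups.

Section Parabolic.
Variables (V : finType) (adj : rel V).

Definition special_subgroup (T : set V) : set (racg adj) :=
  generated (@racg_gen V adj @` T).

Definition parabolic_subgroup (H : set (racg adj)) : Prop :=
  exists T g, H = conj_set g (special_subgroup T).

End Parabolic.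

Section QuasiGeodesics.
Variable R : realType.
Local Open Scope ring_scope.

Definition qgeod_domain (I : set R) : Prop :=
  exists i : interval R,
    I = [set` i] \/ I = [set` i] `&` range (fun z : int => z%:~R).

(* Only the values of [f] on [I] matter. *)
Definition quasi_geodesic (Y : Type) (d : Y -> Y -> R) (K C : R)
    (I : set R) (f : R -> Y) : Prop :=
  qgeod_domain I /\
  forall s t, I s -> I t ->
    K^-1 * `|s - t| - C <= d (f s) (f t) <= K * `|s - t| + C.

Definition has_endpoints (I : set R) (a b : R) : Prop :=
  [/\ I a, I b & forall t, I t -> a <= t <= b].

End QuasiGeodesics.

Section CayleyGraph.
Variables (R : realType) (G : groupType) (A : set G).

Definition expressible (g : G) (n : nat) : Prop :=
  exists w : seq G,
    [/\ size w = n, forall x, x \in w -> A x \/ A x^-1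
      & g = \big[*%g/1]_(x <- w) x].

(* The default value 0 is only used when [A] does not generate [g]. *)
Definition word_length (g : G) : nat :=
  xget 0%N [set n | expressible g n /\ forall m, expressible g m -> (n <= m)%N].

Definition cayley_adj (u v : G) : Prop :=
  u != v /\ exists2 a, A a & v = u * a \/ u = v * a.

Local Open Scope ring_scope.

(* A point of the geometric realisation is a vertex or lies in the interior of
   an edge of length 1: [CayleyEdge u v t] is at distance t from u and 1 - t
   from v, so it is the same point as [CayleyEdge v u (1 - t)]. *)
Inductive cayley_point : Type :=
| CayleyVertex of G
| CayleyEdge (u v : G) (t : R) of cayley_adj u v & 0 < t < 1.

Definition vertex_dist (u v : G) : R := (word_length (u^-1 * v)%g)%:R.

Definition dist_to_vertex (p : cayley_point) (w : G) : R :=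
  match p with
  | CayleyVertex u => vertex_dist u w
  | CayleyEdge u v t _ _ =>
      Num.min (t + vertex_dist u w) (1 - t + vertex_dist v w)
  end.

Definition cayley_dist (p q : cayley_point) : R :=
  match p, q with
  | CayleyVertex u, _ => dist_to_vertex q u
  | _, CayleyVertex u => dist_to_vertex p u
  | CayleyEdge u v t _ _, CayleyEdge u' v' t' _ _ =>
      if (u == u') && (v == v') then `|t - t'|
      else if (u == v') && (v == u') then `|t - (1 - t')|
      else Num.min (t + dist_to_vertex q u) (1 - t + dist_to_vertex q v)
  end.

Definition strongly_quasiconvex (H : set G) : Prop :=
  forall K C : R, 1 <= K -> 0 <= C ->
  exists M : R, forall (I : set R) (f : R -> cayley_point) (a b : R),
    quasi_geodesic cayley_dist K C I f -> has_endpoints I a b ->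
    (exists2 h, H h & f a = CayleyVertex h) ->
    (exists2 h, H h & f b = CayleyVertex h) ->
    forall t, I t -> exists2 h, H h & cayley_dist (f t) (CayleyVertex h) <= M.

End CayleyGraph.

(* Main.v *)
(** Both properties of a conjugate of the special subgroup [W] on [T] are
equivalent to a condition on the graph: if [T] contains a diagonal [a], [c] of an
induced 4-cycle [a], [b], [c], [d], then it contains the whole cycle.

If the condition fails, say [b] is not in [T], then the infinite dihedral groups
on [a], [c] and on [b], [d] span a flat. Three sides of large squares in it are
quasi-geodesics leaving [W] arbitrarily far, and the conjugates of [W] by the
powers of [bd] all contain [ac].

Assume the condition. If all letters of a word without initial letters in [T]
commute with two non-adjacent elements of [T], then the word has no letter in [T]
and its letters commute pairwise, so it has at most [#|V|] letters. A path from
[x] to [y] shorter than the distance of [x] to [W] cancels a word that commutes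
with the difference of the projections of [x] and [y]; so these projections are
close, [W] is strongly contracting, and quasi-geodesics stay near [W]. An
intersection of conjugates of [W] is again parabolic; if it is infinite then,
after a conjugation, it contains two non-adjacent generators, and these commute
with the minimal representatives of all the cosets involved, of which there are
hence boundedly many. *)

From HB Require Import structures.
Require Import Defs.
From mathcomp Require Import all_boot all_order all_algebra.
From mathcomp Require Import boolp classical_sets functions cardinality.
From mathcomp Require Import set_interval reals.
From mathcomp Require Import zify lra.

Set Implicit Arguments.
Unset Strict Implicit.
Unset Printing Implicit Defensive.

Import Order.TTheory GRing.Theory Num.Theory.

Local Open Scope classical_set_scope.
Local Open Scope group_scope.

(** * Cayley graphs *)

Section WordLength.
Variables (G : groupType) (A : set G).

Lemma expressible1 : expressible A 1 0.
Proof. by exists [::]; rewrite big_nil. Qed.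

Lemma expressible_gen a : A a -> expressible A a 1.
Proof.
move=> Aa; exists [:: a]; split; rewrite ?big_seq1 // => x.
by rewrite inE => /eqP->; left.
Qed.

Lemma expressibleM g h m n :
  expressible A g m -> expressible A h n -> expressible A (g * h) (m + n).
Proof.
move=> [u [<- uA ->]] [v [<- vA ->]]; exists (u ++ v).
split; rewrite ?size_cat ?big_cat // => x.
by rewrite mem_cat => /orP[/uA|/vA].
Qed.

Lemma expressibleV g n : expressible A g n -> expressible A g^-1 n.
Proof.
move=> [w [<- wA ->]]; exists [seq x^-1 | x <- rev w]; split.
- by rewrite size_map size_rev.
- move=> _ /mapP[x + ->]; rewrite mem_rev invgK => /wA.
  by case; [right|left].
- by rewrite big_map prodgV revK.
Qed.

Hypothesis A_gen : generated A = setT.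

Lemma word_lengthP g : expressible A g (word_length A g) /\
  forall m, expressible A g m -> (word_length A g <= m)%N.
Proof.
suff [n gn] : exists n, expressible A g n.
  apply: (@xgetPex _ 0%N
    [set n | expressible A g n /\ forall m, expressible A g m -> (n <= m)%N]).
  have ex : exists n, `[< expressible A g n >] by exists n; apply/asboolP.
  case: (ex_minnP ex) => k /asboolP gk kmin; exists k; split=> // m gm.
  by apply: kmin; apply/asboolP.
have : generated A g by rewrite A_gen.
move=> /(_ [set h | exists n, expressible A h n]); apply.
split; [split|] => [|x y [m xm] [n yn]|x [n xn]|x Ax].
- by exists 0%N; apply: expressible1.
- by exists (m + n)%N; apply: expressibleM.
- by exists n; apply: expressibleV.
- by exists 1%N; apply: expressible_gen.
Qed.

Lemma word_lengthM g h :
  (word_length A (g * h)%g <= word_length A g + word_length A h)%N.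
Proof.
have [_ min] := word_lengthP (g * h).
by apply: min; apply: expressibleM; case: (word_lengthP g) (word_lengthP h) => ? _ [].
Qed.

Lemma word_lengthV g : word_length A g^-1 = word_length A g.
Proof.
suff le h : (word_length A h^-1%g <= word_length A h)%N.
  by apply/eqP; rewrite eqn_leq le -{1}(invgK g) le.
have [_] := word_lengthP h^-1; apply; apply: expressibleV.
by case: (word_lengthP h).
Qed.

Lemma word_length1 : word_length A 1 = 0%N.
Proof.
by have [_ /(_ _ expressible1)] := word_lengthP 1; rewrite leqn0 => /eqP.
Qed.

Lemma word_length_gen a : A a -> (word_length A a <= 1)%N.
Proof. by move=> Aa; have [_] := word_lengthP a; apply; apply: expressible_gen. Qed.

Lemma word_length_adj u v : cayley_adj A u v -> (word_length A (u^-1 * v)%g <= 1)%N.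
Proof.
move=> [_ [a Aa [->|->]]]; first by rewrite mulKg word_length_gen.
by rewrite invgM mulgVK word_lengthV word_length_gen.
Qed.

(** Subadditivity turns a bound on generators into a linear bound along any expression. It serves to
    compare the reduced length with the word length of an arbitrary finite generating set. *)
Lemma word_length_dominates (f : G -> nat) L : f 1 = 0%N ->
  (forall g h, (f (g * h)%g <= f g + f h)%N) ->
  (forall a, A a -> (f a <= L)%N /\ (f a^-1%g <= L)%N) ->
  forall g, (f g <= L * word_length A g)%N.
Proof.
move=> f1 fM fA g; have [[w [<- wA eg]] _] := word_lengthP g; rewrite {}eg.
elim: w wA => [_|x w IHw wA]; first by rewrite big_nil f1.
rewrite big_cons /= mulnS; apply: leq_trans (fM _ _) (leq_add _ _).
  by case: (wA x (mem_head _ _)) => /fA[]; rewrite ?invgK.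
by apply: IHw => y yw; apply: wA; rewrite inE yw orbT.
Qed.

Variable R : realType.
Local Open Scope ring_scope.

(** Edge points are rounded to their first endpoint, so that later geometry takes place on group
    elements; by [cayley_dist_near] rounding both points costs at most 2. *)
Definition cayley_vertex (p : cayley_point R A) : G :=
  match p with CayleyVertex u => u | CayleyEdge u _ _ _ _ => u end.

Lemma vertex_distC u v : vertex_dist R A u v = vertex_dist R A v u.
Proof. by rewrite /vertex_dist -word_lengthV invgM invgK. Qed.

Lemma vertex_dist_triangle v u w :
  vertex_dist R A u w <= vertex_dist R A u v + vertex_dist R A v w.
Proof.
rewrite /vertex_dist -natrD ler_nat.
have -> : (u^-1 * w = (u^-1 * v) * (v^-1 * w))%g by rewrite mulgA mulgK.
exact: word_lengthM.
Qed.

Lemma vertex_dist_adj u v w : cayley_adj A u v ->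
  `|vertex_dist R A u w - vertex_dist R A v w| <= 1.
Proof.
move=> uv; have : vertex_dist R A u v <= 1 by rewrite lern1; apply: word_length_adj.
have := vertex_dist_triangle v u w; have := vertex_dist_triangle u v w.
by rewrite (vertex_distC v u) ler_norml; lra.
Qed.

Lemma dist_to_vertex_near p w :
  `|dist_to_vertex p w - vertex_dist R A (cayley_vertex p) w| <= 1.
Proof.
case: p => [u|u v t uv /andP[t0 t1]] /=; first by rewrite subrr normr0.
have := vertex_dist_adj w uv; rewrite !ler_norml minElt.
by case: ltP => ?; lra.
Qed.

Lemma cayley_dist_near p q :
  `|cayley_dist p q - vertex_dist R A (cayley_vertex p) (cayley_vertex q)| <= 2.
Proof.
case: p => [u|u v t uv t01].
  by have := dist_to_vertex_near q u; rewrite vertex_distC /=; lra.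
case: q => [u'|u' v' t' uv' t01'].
  by have := dist_to_vertex_near (CayleyEdge uv t01) u'; rewrite /=; lra.
have := t01; have := t01' => /andP[t'0 t'1] /andP[t0 t1].
have d0 : vertex_dist R A u u = 0 by rewrite /vertex_dist mulVg word_length1.
rewrite [cayley_vertex _]/= [cayley_vertex _]/= /cayley_dist.
case: ifP => [/andP[/eqP eu _]|_].
  by rewrite -eu d0 subr0 ler_norml; case: (lerP t t') => ?; lra.
case: ifP => [/andP[/eqP eu /eqP ev]|_].
  have : vertex_dist R A u v <= 1 by rewrite lern1; apply: word_length_adj.
  have : 0 <= vertex_dist R A u v by [].
  by rewrite /= -ev !ler_norml; case: (lerP t (1 - t')) => ?; lra.
have near w : `|dist_to_vertex (CayleyEdge uv' t01') w - vertex_dist R A u' w| <= 1.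
  exact: dist_to_vertex_near.
have := near u; have := near v; have := vertex_dist_adj u' uv.
rewrite (vertex_distC u u') (vertex_distC v u').
rewrite !ler_norml minElt.
by case: ltP => ?; lra.
Qed.

End WordLength.

Lemma normr_natB (R : realDomainType) (k l : nat) :
  `|k%:R - l%:R|%R = (k - l + (l - k))%:R%R :> R.
Proof.
case/orP: (leq_total k l) => kl; last first.
  by rewrite -natrB // normr_nat (eqP kl) addn0.
by rewrite distrC -natrB // normr_nat (eqP kl).
Qed.

(* Coordinates of the path that runs along three sides of an [n]-by-[n] square. *)
Definition detour_x n k := (minn k n - (k - 2 * n))%N.
Definition detour_y n k := (minn (k - n) n)%N.

Lemma detourP n k : (k <= 3 * n)%N ->
  [\/ (k <= n)%N /\ detour_x n k = k /\ detour_y n k = 0%N,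
     (n <= k <= 2 * n)%N /\ detour_x n k = n /\ detour_y n k = (k - n)%N |
     (2 * n <= k)%N /\ detour_x n k = (3 * n - k)%N /\ detour_y n k = n].
Proof.
rewrite /detour_x /detour_y => kn.
case: (leqP k n) => ?; first by constructor 1; lia.
by case: (leqP k (2 * n)) => ?; [constructor 2|constructor 3]; lia.
Qed.

(** Here [d] is the distance in the sum norm. The factor 3 is attained by the ends of the path,
    which are [n] apart at parameters 0 and [3 * n]. *)
Lemma detour_dist n k l : (k <= 3 * n)%N -> (l <= 3 * n)%N ->
  let d := (detour_x n k - detour_x n l + (detour_x n l - detour_x n k) +
    (detour_y n k - detour_y n l + (detour_y n l - detour_y n k)))%N in
  (d <= k - l + (l - k))%N /\ (k - l + (l - k) <= 3 * d)%N.
Proof.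
move=> kn ln; have := detourP kn; have := detourP ln; move: kn ln.
move: (detour_x n l) (detour_y n l) (detour_x n k) (detour_y n k).
move=> x' y' x y kn ln [] [? [-> ->]] [] [? [-> ->]] /=; split; lia.
Qed.

Lemma finite_heightP (G : groupType) (H : set G) :
  finite_height H <-> exists n, height_bound H n.
Proof.
split=> [[n [nH _]]|[n nH]]; first by exists n.
have ex : exists n, `[< height_bound H n >] by exists n; apply/asboolP.
case: (ex_minnP ex) => k /asboolP kH kmin; exists k; split=> // m mH.
by apply: kmin; apply/asboolP.
Qed.

(** * Reduced words and descents *)

Section Racg.
Variables (V : finType) (adj : rel V).
Hypotheses (adj_sym : symmetric adj) (adj_irr : irreflexive adj).

Local Notation G := (racg adj).
Local Notation gen := (@racg_gen V adj).

(* Rewriting with [mulgA] and its kin changes the instance of the product up to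
conversion only, which hides equal lengths from [lia]. *)
Lemma mulA (x y z : G) : x * (y * z) = x * y * z. Proof. exact: mulgA. Qed.
Lemma invM (x y : G) : (x * y)^-1 = y^-1 * x^-1. Proof. exact: invgM. Qed.
Lemma mul1w (x : G) : 1 * x = x. Proof. exact: mul1g. Qed.
Lemma mulw1 (x : G) : x * 1 = x. Proof. exact: mulg1. Qed.

Lemma genK s : gen s * gen s = 1.
Proof.
rewrite /racg_gen [LHS]pres_mulE; apply/word_classP.
exact: (word_eq_rel [::] [::] (racg_square adj s)).
Qed.

Lemma gen_inv s : (gen s)^-1 = gen s.
Proof. by rewrite -[LHS]mulw1 -(genK s) mulA mulVg mul1w. Qed.

Lemma gen_comm s t : adj s t -> gen s * gen t = gen t * gen s.
Proof.
move=> st; rewrite /racg_gen [LHS]pres_mulE [RHS]pres_mulE; apply/word_classP.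
exact: (word_eq_rel [::] [::] (racg_commute st)).
Qed.

Lemma genKl s (g : G) : gen s * (gen s * g) = g.
Proof. by rewrite mulA genK mul1w. Qed.

Definition wprod (w : seq V) : G := foldr (fun s g => gen s * g) 1 w.

Lemma wprod_cat u v : wprod (u ++ v) = wprod u * wprod v.
Proof. by elim: u => [|s u IHu] /=; rewrite ?mul1w // IHu mulA. Qed.

Lemma wprod_rev w : wprod (rev w) = (wprod w)^-1.
Proof.
elim: w => [|s w IHw]; first by rewrite /= invg1.
by rewrite rev_cons -cats1 wprod_cat IHw /= mulw1 invM gen_inv.
Qed.

Lemma word_class_wprod (w : seq (letter V)) :
  word_class (racg_rel adj) w = wprod (map fst w).
Proof.
elim: w => [|[s b] w IHw] //=.
rewrite -IHw -cat1s -pres_mulE; congr (_ * _).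
case: b => //.
have e : word_class (racg_rel adj) [:: (s, false)] * gen s = 1.
  rewrite [LHS]pres_mulE; apply/word_classP.
  by apply: (word_eq_cancel _ [::] [::] (s, false)).
by rewrite -[LHS]mulw1 -(genK s) mulA e mul1w.
Qed.

Lemma wprod_surj (g : G) : exists w, wprod w = g.
Proof. by exists (map fst (word_repr g)); rewrite -word_class_wprod word_reprK. Qed.

(* The dual geometric representation, with Cartan integers 2, 0 (adjacent) and -2
(non-adjacent). Started from the constant function 1, the sign at [s] tells
whether [s] is a left descent. *)
Definition reflection s (f : V -> int) (t : V) : int :=
  (if t == s then - f s else if adj s t then f t else f t + (f s + f s))%R.

Lemma reflectionK s f : reflection s (reflection s f) = f.
Proof.
apply/funext => t; rewrite /reflection eqxx; case: eqP => [->|_]; first by rewrite opprK.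
by case: (adj s t); lia.
Qed.

Lemma reflection_comm s t f : adj s t ->
  reflection s (reflection t f) = reflection t (reflection s f).
Proof.
move=> st; have ts : adj t s by rewrite adj_sym.
apply/funext => u; rewrite /reflection st ts.
have /negbTE nst : s != t by apply: contraTneq st => ->; rewrite adj_irr.
have nts : (t == s) = false by rewrite eq_sym.
rewrite nst nts.
case: (eqVneq u s) => [->|_]; first by rewrite nst ?ts.
case: (eqVneq u t) => [->|_]; first by rewrite ?nst ?st.
by case: (adj s u); case: (adj t u); lia.
Qed.

Definition weight (w : seq V) : V -> int := foldr reflection (fun=> 1%R) w.

(** The reflections satisfy the defining relations, so they give an action of the group, and
    [weight] depends only on the element that a word represents. *)
Lemma word_eq_reflection u v : word_eq (racg_rel adj) u v ->
  forall f, foldr reflection f (map fst u) = foldr reflection f (map fst v).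
Proof.
elim=> [//|u' v' _ IH f|u' v' w _ IH1 _ IH2 f|p q a f|p q _ _ [s|s t st] f].
- by rewrite IH.
- by rewrite IH1.
- by rewrite !map_cat !foldr_cat /= reflectionK.
- by rewrite !map_cat !foldr_cat /= reflectionK.
- by rewrite !map_cat !foldr_cat /= reflection_comm.
Qed.

Lemma weight_wprod u v : wprod u = wprod v -> weight u = weight v.
Proof.
have mk (w : seq V) : w = map fst [seq (s, true) | s <- w] by rewrite -map_comp map_id.
rewrite (mk u) (mk v) -!word_class_wprod => /word_classP e.
exact: word_eq_reflection.
Qed.

(** No letter is a left descent of what follows it. By [len_reduced] and [len_wprod] these are the
    words of minimal length. *)
Fixpoint reduced (w : seq V) : bool :=
  if w is s :: w' then (0 < weight w' s)%R && reduced w' else true.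

Lemma reduced_inv w : reduced w -> (forall s, weight w s != 0%R) /\
  (forall s t, s != t -> ~~ adj s t -> 0 < weight w s + weight w t)%R.
Proof.
elim: w => [_|r w IHw /= /andP[r0 /IHw[nz pos]]]; first by split.
have pos' t : t != r -> ~~ adj r t -> (0 < weight w t + weight w r)%R.
  by move=> tr rt; apply: pos; rewrite // adj_sym.
split=> [s|s t st nst]; rewrite /reflection.
  case: (eqVneq s r) => [_|sr]; first by rewrite oppr_eq0 nz.
  case: ifPn => [//|rs]; have := pos' s sr rs; lia.
case: (eqVneq s r) => sr; case: (eqVneq t r) => tr.
- by rewrite sr tr eqxx in st.
- by rewrite -sr (negbTE nst); have := pos _ _ st nst; rewrite sr; lia.
- by rewrite -tr adj_sym (negbTE nst); have := pos _ _ st nst; rewrite tr; lia.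
- by have := pos _ _ st nst; case: (adj r s); case: (adj r t); lia.
Qed.

Lemma reduced_cons_descent r w t : reduced (r :: w) ->
  (weight (r :: w) t < 0)%R = (t == r) || (adj r t && (weight w t < 0)%R).
Proof.
move=> /= /andP[r0 /reduced_inv[nz pos]]; rewrite /reflection.
case: (eqVneq t r) => [->|tr] /=; first by lia.
case: ifPn => //= rt; have := pos t r tr; rewrite adj_sym => /(_ rt); lia.
Qed.

(** By [reduced_cons_descent] a descent is the first letter, or it commutes with that letter and is
    a descent of the rest; so it can be shuffled to the front. *)
Lemma reduced_exchange w s : reduced w -> (weight w s < 0)%R ->
  exists w', [/\ reduced w', perm_eq w (s :: w') & wprod w = gen s * wprod w'].
Proof.
elim: w => [//|t w IHw] ascw; rewrite reduced_cons_descent //.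
case/orP=> [/eqP->|/andP[ts ws]]; first by exists w; case/andP: ascw.
have /andP[t0 aw] := ascw.
have [w' [aw' pw ew]] := IHw aw ws.
exists (t :: w'); split.
- rewrite /= aw' andbT.
  have: weight w t = weight (s :: w') t by rewrite (@weight_wprod w (s :: w')).
  rewrite /= /reflection adj_sym ts; case: eqP => [e|_ <- //].
  by rewrite e adj_irr in ts.
- rewrite -(perm_cons t) in pw; apply: perm_trans pw _.
  by rewrite -[t :: s :: w']/([:: t] ++ [:: s] ++ w') perm_catCA.
- by rewrite /= ew !mulA (gen_comm ts).
Qed.

Lemma reduced_exists u : exists w, [/\ reduced w, wprod w = wprod u & {subset w <= u}].
Proof.
elim: u => [|s u [w [aw ew sw]]]; first by exists [::].
have sw' : {subset w <= s :: u} by move=> x /sw; rewrite inE orbC => ->.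
have [ws|ws|ws] := ltgtP (weight w s) 0%R.
- have [w' [aw' pw ew']] := reduced_exchange aw ws.
  exists w'; split=> //; first by rewrite /= -ew ew' genKl.
  by move=> x xw; apply: sw'; rewrite (perm_mem pw) inE xw orbT.
- exists (s :: w); split=> //=; first by rewrite ws.
    by rewrite ew.
  by move=> x; rewrite !inE; case: (x == s) => //= /sw.
- by have [nz _] := reduced_inv aw; have := nz s; rewrite ws eqxx.
Qed.

(** The first letter of [w] is a descent of [w'], so it can be moved to the front there and
    cancelled from both. This makes [len] independent of the chosen reduced word. *)
Lemma reduced_perm w w' : reduced w -> reduced w' -> wprod w = wprod w' -> perm_eq w w'.
Proof.
elim: w w' => [|s w IHw] w' aw aw' e.
  case: w' aw' e => //= s w' /andP[s0 aw'] e.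
  have := @weight_wprod [::] (s :: w') e; move=> /(congr1 (fun f => f s)).
  by rewrite /= /reflection eqxx; lia.
have : (weight w' s < 0)%R by rewrite -(weight_wprod e) reduced_cons_descent // eqxx.
move=> /(reduced_exchange aw')[w'' [aw'' pw ew]].
rewrite perm_sym; apply: perm_trans pw _; rewrite perm_cons perm_sym.
apply: IHw => //; first by case/andP: aw.
by move: e; rewrite ew /= => /mulgI.
Qed.

(** * Length and descents of group elements *)

Lemma reduced_word_exists (g : G) : exists w, reduced w /\ wprod w = g.
Proof.
by have [u <-] := wprod_surj g; have [w [aw ew _]] := reduced_exists u; exists w.
Qed.

Definition rword (g : G) : seq V := sval (cid (reduced_word_exists g)).

Lemma rwordK (g : G) : wprod (rword g) = g.
Proof. by rewrite /rword; case: cid => w []. Qed.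

Lemma reduced_rword (g : G) : reduced (rword g).
Proof. by rewrite /rword; case: cid => w []. Qed.

Definition len (g : G) : nat := size (rword g).

Definition descent (g : G) (s : V) : bool := (weight (rword g) s < 0)%R.

Lemma descent_wprod w s : descent (wprod w) s = (weight w s < 0)%R.
Proof. by rewrite /descent (@weight_wprod (rword (wprod w)) w) ?rwordK. Qed.

Lemma len_reduced w : reduced w -> len (wprod w) = size w.
Proof. by move=> aw; apply/perm_size/reduced_perm; rewrite ?reduced_rword ?rwordK. Qed.

Lemma reduced_consE s w : reduced (s :: w) = ~~ descent (wprod w) s && reduced w.
Proof.
rewrite descent_wprod /=; case aw: (reduced w); rewrite ?andbF // !andbT.
by have [nz _] := reduced_inv aw; have := nz s; lia.
Qed.

Lemma reduced_cons s w : reduced w -> ~~ descent (wprod w) s -> reduced (s :: w).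
Proof. by rewrite reduced_consE => -> ->. Qed.

Arguments reduced : simpl never.

Lemma desc1 s : descent 1 s = false.
Proof. by rewrite (descent_wprod [::]). Qed.

Lemma len1 : len 1 = 0%N.
Proof. exact: (@len_reduced [::]). Qed.

Lemma descent_gen_self s g : descent (gen s * g) s = ~~ descent g s.
Proof.
have [nz _] := reduced_inv (reduced_rword g); have := nz s.
rewrite -{2 3}(rwordK g) -[gen s * _]/(wprod (s :: rword g)) !descent_wprod /=.
by rewrite /reflection eqxx; lia.
Qed.

Lemma descent_gen_adj s t g : adj s t -> descent (gen s * g) t = descent g t.
Proof.
move=> st; rewrite -(rwordK g) -[gen s * _]/(wprod (s :: rword g)) !descent_wprod /= /reflection st.
by case: eqP => // e; rewrite e adj_irr in st.
Qed.

Lemma descent_gen_nadj s t g :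
  ~~ descent g s -> t != s -> ~~ adj s t -> descent (gen s * g) t = false.
Proof.
move=> gs ts /negbTE st; have: reduced (s :: rword g).
  by rewrite reduced_cons ?reduced_rword ?rwordK.
move=> a; rewrite -(rwordK g) -[gen s * _]/(wprod (s :: rword g)) descent_wprod.
rewrite reduced_cons_descent //.
by rewrite (negbTE ts) st.
Qed.

Lemma len_up g s : ~~ descent g s -> len (gen s * g) = (len g).+1.
Proof.
move=> gs; have: reduced (s :: rword g) by rewrite reduced_cons ?reduced_rword ?rwordK.
by move/len_reduced; rewrite /= rwordK.
Qed.

Lemma len_down g s : descent g s -> len g = (len (gen s * g)).+1.
Proof.
by move=> gs; rewrite -(@len_up _ s) ?genKl // descent_gen_self negbK.
Qed.

Lemma len_gen s g : (len (gen s * g)%g <= (len g).+1)%N.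
Proof. by case: (boolP (descent g s)) => [/len_down ->|/len_up ->]; lia. Qed.

Lemma len_wprod w : (len (wprod w) <= size w)%N.
Proof.
elim: w => [|s w IHw]; first by rewrite len1.
by rewrite /=; have := len_gen s (wprod w); lia.
Qed.

Lemma lenV g : len g^-1 = len g.
Proof.
suff le h : (len h^-1%g <= len h)%N by apply/eqP; rewrite eqn_leq le -{1}(invgK g) le.
by have := len_wprod (rev (rword h)); rewrite wprod_rev rwordK size_rev.
Qed.

Lemma lenM g h : (len (g * h)%g <= len g + len h)%N.
Proof.
by have := len_wprod (rword g ++ rword h); rewrite wprod_cat !rwordK size_cat.
Qed.

Lemma reduced_len w : len (wprod w) = size w -> reduced w.
Proof.
elim: w => [//|s w IHw] /= e.
have le := len_wprod w; have le' := len_gen s (wprod w).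
rewrite reduced_cons //; first by apply: IHw; lia.
by apply/negP => /len_down; lia.
Qed.

Lemma reduced_cat_inv u v : reduced (u ++ v) -> reduced u /\ reduced v.
Proof.
move=> a; have e := len_reduced a; rewrite wprod_cat size_cat in e.
have := lenM (wprod u) (wprod v); have := len_wprod u; have := len_wprod v.
by split; apply: reduced_len; lia.
Qed.

Lemma len0 g : len g = 0%N -> g = 1.
Proof. by move/size0nil => e; rewrite -(rwordK g) e. Qed.

Lemma descent_mem w s : descent (wprod w) s -> s \in w.
Proof.
have [w' [aw' e sw]] := reduced_exists w.
rewrite -e descent_wprod => /(reduced_exchange aw')[v [_ /perm_mem pv _]].
by apply: sw; rewrite pv mem_head.
Qed.

(** Prepending a letter preserves a different descent only if the two are adjacent; so a descent
    that comes from [v] must pass all of [u]. *)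
Lemma descent_cat u v s : reduced (u ++ v) -> descent (wprod (u ++ v)) s ->
  descent (wprod u) s \/ all (adj s) u /\ descent (wprod v) s.
Proof.
elim: u => [|r u IHu]; first by right.
move=> a; have [] := reduced_cat_inv a.
move: a; rewrite /= !reduced_consE => /andP[nr a] /andP[nu au] av.
have [->|sr] := eqVneq s r; first by left; rewrite descent_gen_self.
case: (boolP (adj r s)) => rs; last by rewrite descent_gen_nadj.
rewrite !(descent_gen_adj _ rs) adj_sym rs /=; exact: IHu.
Qed.

Lemma descent_front u s v :
  reduced (u ++ s :: v) -> all (adj s) u -> descent (wprod (u ++ s :: v)) s.
Proof.
elim: u => [|r u IHu] /=.
  by rewrite reduced_consE descent_gen_self => /andP[].
rewrite reduced_consE => /andP[_ a] /andP[sr su].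
by rewrite descent_gen_adj ?IHu // adj_sym.
Qed.

(** The second copy of a repeated letter could be shuffled next to the first, since everything in
    between commutes with it, and would cancel; hence the letters are distinct. *)
Lemma reduced_clique_size w : reduced w ->
  {in w &, forall s t, s != t -> adj s t} -> (size w <= #|V|)%N.
Proof.
move=> aw cl; suff: uniq w by move/card_uniqP <-; exact: max_card.
elim: w aw cl => [//|s w IHw]; rewrite reduced_consE => /andP[ns aw] cl /=.
have uw : uniq w by apply: IHw => // x y xw yw; apply: cl; rewrite inE ?xw ?yw orbT.
rewrite uw andbT; apply: contra ns => sw.
move: sw aw cl uw {IHw}; case/splitPr => u v aw cl uw.
apply: descent_front aw _; apply/allP => t tu.
apply: cl; rewrite ?mem_head //; first by rewrite inE mem_cat tu orbT.
by apply: contraTneq uw => ->; rewrite cat_uniq /= tu andbF.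
Qed.

(** * Special subgroups and minimal coset representatives *)

Lemma specialP (T : set V) g : @special_subgroup V adj T g <->
  exists w, [/\ reduced w, (forall s, s \in w -> T s) & wprod w = g].
Proof.
split=> [|[w [_ wT <-]]]; last first.
  move=> B [[B1 BM _] genB]; elim: w wT => [//|s w IHw] wT /=.
  apply: BM; first by apply: genB; exists s => //; apply: wT; rewrite mem_head.
  by apply: IHw => t tw; apply: wT; rewrite inE tw orbT.
pose B g := exists2 w, (forall s, s \in w -> T s) & wprod w = g.
move=> /(_ B)[|w wT <-].
- split.
  + split; first by exists [::].
      move=> _ _ [u uT <-] [v vT <-]; exists (u ++ v); last exact: wprod_cat.
      by move=> s; rewrite mem_cat => /orP[/uT|/vT].
    move=> _ [u uT <-]; exists (rev u); last exact: wprod_rev.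
    by move=> s; rewrite mem_rev => /uT.
  + move=> _ [s Ts <-]; exists [:: s]; last by rewrite /= mulw1.
    by move=> t; rewrite inE => /eqP->.
- by have [w' [aw' e sw]] := reduced_exists w; exists w'; split=> // s /sw/wT.
Qed.

Lemma special_wprod (T : set V) w :
  (forall s, s \in w -> T s) -> @special_subgroup V adj T (wprod w).
Proof.
by move=> wT; apply/specialP; have [v [av e sv]] := reduced_exists w; exists v; split=> // s /sv/wT.
Qed.

Lemma special_descent (T : set V) g s : @special_subgroup V adj T g -> descent g s -> T s.
Proof. by move=> /specialP[w [_ wT <-]] /descent_mem/wT. Qed.

Lemma special_gen (T : set V) s : T s -> @special_subgroup V adj T (gen s).
Proof. by move=> Ts B [_]; apply; exists s. Qed.

Section Special.
Variable T : set V.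
Local Notation W := (@special_subgroup V adj T).

Lemma special1 : W 1.
Proof. by move=> B [[]]. Qed.

Lemma specialM g h : W g -> W h -> W (g * h).
Proof. by move=> Wg Wh B BA; have [[_ BM _] _] := BA; apply: BM; [apply: Wg|apply: Wh]. Qed.

Lemma specialV g : W g -> W g^-1.
Proof. by move=> Wg B BA; have [[_ _ BV] _] := BA; apply: BV; apply: Wg. Qed.

Lemma special_ind (P : G -> Prop) : P 1 ->
  (forall s g, T s -> W g -> ~~ descent g s -> P g -> P (gen s * g)) ->
  forall g, W g -> P g.
Proof.
move=> P1 PS g /specialP[w [aw wT <-]] {g}.
elim: w aw wT => [//|s w IHw]; rewrite reduced_consE => /andP[ns aw] wT.
have wT' t : t \in w -> T t by move=> tw; apply: wT; rewrite inE tw orbT.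
apply: PS => //; [by apply: wT; rewrite mem_head|exact: special_wprod|exact: IHw].
Qed.

(* [h] is the shortest element of [W h]. *)
Definition left_min (h : G) : Prop := forall s, T s -> ~~ descent h s.

(** Prepending a letter of [T] changes the descents in [T] by rules that mention only these
    descents, and at the start neither 1 nor [h] has any. *)
Lemma left_min_descent x h s : left_min h -> W x -> T s ->
  descent (x * h) s = descent x s.
Proof.
move=> hmin Wx; move: x Wx s; apply: special_ind => [s|r x Tr Wx nr IHx s] Ts.
  by rewrite mul1w desc1; apply/negbTE/hmin.
rewrite -mulA; have [->|sr] := eqVneq s r.
  by rewrite !descent_gen_self IHx.
case: (boolP (adj r s)) => rs; first by rewrite !descent_gen_adj ?IHx.
by rewrite !descent_gen_nadj // IHx.
Qed.

Lemma left_min_len x h : left_min h -> W x -> len (x * h) = (len x + len h)%N.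
Proof.
move=> hmin; move: x; apply: special_ind => [|r x Tr Wx nr IHx]; first by rewrite mul1w len1.
have nr' : ~~ descent (x * h) r by rewrite left_min_descent.
by rewrite -mulA (len_up nr') (len_up nr) IHx.
Qed.

Lemma left_min_exists g : exists x h, [/\ W x, left_min h & g = x * h].
Proof.
elim: {g}(len g) {-2}g (erefl (len g)) => [|n IHn] g.
  move=> /len0 ->; exists 1, 1; split; rewrite ?mulw1 //; first exact: special1.
  by move=> s _; rewrite desc1.
move=> lg; case: (pselect (exists2 s, T s & descent g s)) => [[s Ts gs]|ng].
  have [|x [h [Wx hmin e]]] := IHn (gen s * g).
    by have := len_down gs; lia.
  exists (gen s * x), h; split=> //; last by rewrite -mulA -e genKl.
  by apply: specialM => //; apply: special_gen.
exists 1, g; split; rewrite ?mul1w //; first exact: special1.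
by move=> s Ts; apply/negP => gs; apply: ng; exists s.
Qed.

End Special.

(** * Strong contraction of special subgroups *)

Lemma wprod_comm s w : all (adj s) w -> gen s * wprod w = wprod w * gen s.
Proof.
elim: w => [|t w IHw] /=; first by rewrite mulw1 mul1w.
by case/andP=> st /IHw e; rewrite mulA (gen_comm st) -mulA e mulA.
Qed.

Lemma descent_mulg g h s : len (g * h) = (len g + len h)%N -> descent (g * h) s ->
  descent g s \/ all (adj s) (rword g) /\ descent h s.
Proof.
move=> l; have a : reduced (rword g ++ rword h).
  by apply: reduced_len; rewrite wprod_cat !rwordK l size_cat.
by have := descent_cat (s := s) a; rewrite wprod_cat !rwordK.
Qed.

Lemma descent_prefix g h s :
  len (g * h) = (len g + len h)%N -> descent g s -> descent (g * h) s.
Proof.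
move=> l /len_down ld; apply/negP => /negP/len_up; rewrite mulA => lu.
by have := lenM (gen s * g) h; lia.
Qed.

(** The first letter [s] of [x] is moved over to [z]. No new common descent arises: if [t] is
    adjacent to [s] it would already be a descent of both [x] and [z], and otherwise it is no
    descent of [gen s * z]. *)
Lemma len_disjoint_descent x z :
  (forall s, descent x s -> ~~ descent z s) -> len (x^-1 * z) = (len x + len z)%N.
Proof.
rewrite -(rwordK x); elim: (rword x) (reduced_rword x) z => [_ z _|s w IHw a z dis].
  by rewrite len1 invg1 mul1w.
have := a; rewrite reduced_consE => /andP[ns aw].
have nz : ~~ descent z s by apply: dis; rewrite /= descent_gen_self.
rewrite /= invM gen_inv -mulA IHw //; first by rewrite !len_up //; lia.
move=> t wt; have [e|ts] := eqVneq t s; first by rewrite e (negbTE ns) in wt.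
case: (boolP (adj s t)) => st; last by rewrite descent_gen_nadj.
by rewrite descent_gen_adj //; apply: dis; rewrite /= descent_gen_adj.
Qed.

(* [m] is the meet of [x] and [z] in the left weak order. *)
Lemma meet_exists x z : exists m x1 z1,
  [/\ x = m * x1, z = m * z1, len x = (len m + len x1)%N,
      len z = (len m + len z1)%N & len (x^-1 * z) = (len x1 + len z1)%N].
Proof.
elim: {x}(len x) {-2}x z (erefl (len x)) => [|n IHn] x z lx.
  exists 1, x, z; rewrite !mul1w len1 (len0 lx) invg1 mul1w len1; split=> //.
case: (pselect (exists2 s, descent x s & descent z s)) => [[s xs zs]|nd]; last first.
  exists 1, x, z; rewrite !mul1w len1; split=> //; apply: len_disjoint_descent.
  by move=> s xs; apply/negP => zs; apply: nd; exists s.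
have lxs := len_down xs; have lzs := len_down zs.
have [|m [x1 [z1 [ex ez lx1 lz1 l]]]] := IHn (gen s * x) (gen s * z); first lia.
have lm : len (gen s * m) = (len m).+1.
  have := len_gen s m; have := lenM (gen s * m) x1.
  by rewrite -mulA -ex genKl; lia.
exists (gen s * m), x1, z1; split; rewrite ?lm; try lia.
- by rewrite -mulA -ex genKl.
- by rewrite -mulA -ez genKl.
- by rewrite -l invM gen_inv -mulA genKl.
Qed.

(** The first letter of [P] is a descent of [m * z] but not of the minimal [m], so it commutes with
    all letters of [m] and is a descent of [z]. Cancelling it leaves the same situation for a
    shorter [P]. *)
Lemma rect_comm (T : set V) P y m z : reduced P -> (forall s, s \in P -> T s) ->
  len (wprod P * y) = (size P + len y)%N -> len (m * z) = (len m + len z)%N ->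
  left_min T m -> wprod P * y = m * z -> forall s, s \in P -> all (adj s) (rword m).
Proof.
move=> + + + + mmin.
elim: P z => [//|s P IHP] z aP PT lP lm e.
have := aP; rewrite reduced_consE => /andP[ns aP'].
have lPy : len (wprod P * y) = (size P + len y)%N.
  have := lenM (wprod P) y; have := len_gen s (wprod P * y).
  by rewrite (len_reduced aP'); rewrite /= -mulA in lP; lia.
have : descent (m * z) s.
  rewrite -e; apply: descent_prefix; last by rewrite /= descent_gen_self.
  by rewrite lP (len_reduced aP).
case/(descent_mulg lm) => [ms|[sm zs]].
  by have := mmin s (PT s (mem_head _ _)); rewrite ms.
have sm' : gen s * m = m * gen s by rewrite -{1}(rwordK m) wprod_comm // rwordK.
have e' : wprod P * y = m * (gen s * z).
  by rewrite mulA -sm' -mulA -e /= -!mulA genKl.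
have lm' : len (m * (gen s * z)) = (len m + len (gen s * z)%g)%N.
  have := len_down zs; rewrite -e' lPy; move: lP; rewrite e lm /=; lia.
move=> t; rewrite inE => /orP[/eqP->//|]; apply: (IHP (gen s * z)) => //.
by move=> r rP; apply: PT; rewrite inE rP orbT.
Qed.

(* [T] contains every induced 4-cycle of which it contains a diagonal [a], [c];
that [d] lies in [T] follows by exchanging [b] and [d]. *)
Definition square_closed (T : set V) : Prop := forall a b c d,
  T a -> T c -> a != c -> ~~ adj a c -> b != d -> ~~ adj b d ->
  adj a b -> adj b c -> adj c d -> adj d a -> T b.

(** Two non-adjacent letters of [h] would form an induced square with [a] and [c] and hence lie in
    [T]. Minimality of [h] keeps letters of [T] out, so the letters of [h] form a clique. *)
Lemma square_closed_len (T : set V) a c h : square_closed T ->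
  T a -> T c -> a != c -> ~~ adj a c -> left_min T h ->
  all (adj a) (rword h) -> all (adj c) (rword h) -> (len h <= #|V|)%N.
Proof.
move=> Tcl Ta Tc ac nac hmin /allP ah /allP ch.
have sq s t : s \in rword h -> t \in rword h -> s != t -> ~~ adj s t -> T s.
  move=> sh th st nst; apply: (Tcl a s c t) => //; first exact: ah.
  - by rewrite adj_sym; apply: ch.
  - exact: ch.
  - by rewrite adj_sym; apply: ah.
(* A descent [t] in [T] survives prepending a letter [s] outside [T]: if the two were not adjacent,
   [sq] would put [s] into [T]. *)
have key w : reduced w -> {subset w <= rword h} ->
    (exists2 t, T t & descent (wprod w) t) \/ (forall s, s \in w -> ~ T s).
  elim: w => [_ _|s w IHw]; first by right.
  rewrite reduced_consE => /andP[ns aw] wh.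
  have sh : s \in rword h by apply: wh; rewrite mem_head.
  case: (pselect (T s)) => [Ts|nTs].
    by left; exists s; rewrite /= ?descent_gen_self.
  have wh' : {subset w <= rword h} by move=> t tw; apply: wh; rewrite inE tw orbT.
  case: (IHw aw wh') => [[t Tt wt]|nT].
    left; exists t => //; rewrite /= descent_gen_adj //.
    apply: contrapT => /negP nst; apply: nTs; apply: (sq s t) => //.
      by apply: wh'; apply: descent_mem wt.
    by apply: contraNneq ns => ->.
  by right=> t; rewrite inE => /orP[/eqP->|/nT].
apply: reduced_clique_size; first exact: reduced_rword.
case: (key (rword h) (reduced_rword h)) => // [[t Tt]|nT s t sh th st].
  by rewrite rwordK => ht; have := hmin t Tt; rewrite ht.
by apply: contrapT => /negP nst; apply: (nT s sh); apply: (sq s t).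
Qed.

Lemma nonadjacent_pair (w : seq V) : reduced w -> (#|V| < size w)%N ->
  exists a c, [/\ a \in w, c \in w, a != c & ~~ adj a c].
Proof.
move=> aw sw; apply: contrapT => nac.
have := reduced_clique_size aw; rewrite leqNgt sw => /(_ _)/notF; apply => s t ws wt st.
by apply: contrapT => /negP nst; apply: nac; exists s, t.
Qed.

(** Let [m] be the meet of [x] and [p * y]. The short distance makes [m] longer than the remainder
    [z1] of [p * y], so [len p > 2 * #|V|] would force [len m > #|V|]. But then [p] has two
    non-adjacent letters, both commuting with [m], against [square_closed_len]. *)
Lemma square_closed_contract (T : set V) x p y : square_closed T ->
  left_min T x -> left_min T y -> @special_subgroup V adj T p ->
  (len (x^-1 * (p * y))%g < len x)%N -> (len p <= 2 * #|V|)%N.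
Proof.
move=> Tcl xmin ymin Wp; have lpy := left_min_len ymin Wp.
have [m [x1 [z1 [ex ez lx lz ->]]]] := meet_exists x (p * y) => lt.
rewrite leqNgt; apply/negP => gt.
have /specialP[P [aP PT eP]] := Wp; have sP := len_reduced aP; rewrite eP in sP.
have mmin : left_min T m.
  move=> s Ts; apply/negP => ms; have := xmin s Ts; rewrite ex descent_prefix //.
  by rewrite -ex.
have cm s : s \in P -> all (adj s) (rword m).
  have e : wprod P * y = m * z1 by rewrite eP.
  by apply: (rect_comm aP PT _ _ mmin e); rewrite ?eP -?ez -?sP.
have [|a [c [aP' cP ac nac]]] := nonadjacent_pair aP; first by lia.
have := square_closed_len Tcl (PT a aP') (PT c cP) ac nac mmin (cm a aP') (cm c cP).
lia.
Qed.

(** * Nearest point projection and the Morse property *)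

Definition dist (x y : G) : nat := len (x^-1 * y).

Lemma distC x y : dist x y = dist y x.
Proof. by rewrite /dist -lenV invM invgK. Qed.

Lemma dist_triangle y x z : (dist x z <= dist x y + dist y z)%N.
Proof.
have -> : dist x z = len ((x^-1 * y) * (y^-1 * z)) by rewrite mulA mulgK.
exact: lenM.
Qed.

Section Projection.
Variable T : set V.
Local Notation W := (@special_subgroup V adj T).

Lemma proj_exists g : exists x, W x /\ left_min T (x^-1 * g).
Proof.
by have [x [h [Wx hmin ->]]] := left_min_exists T g; exists x; rewrite mulKg.
Qed.

(* The nearest point projection onto [W]. *)
Definition proj g : G := sval (cid (proj_exists g)).

Definition dist_special g : nat := dist (proj g) g.

Lemma proj_special g : W (proj g).
Proof. by rewrite /proj; case: cid => x []. Qed.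

Lemma proj_left_min g : left_min T ((proj g)^-1 * g).
Proof. by rewrite /proj; case: cid => x []. Qed.

Lemma dist_special_le t g : W t -> (dist_special g <= dist t g)%N.
Proof.
move=> Wt; have -> : dist t g = len ((t^-1 * proj g) * ((proj g)^-1 * g)).
  by rewrite mulA mulgK.
rewrite (left_min_len (proj_left_min g)) ?leq_addl //.
by apply: specialM (proj_special g); apply: specialV.
Qed.

Lemma dist_special_lip x y : (dist_special y <= dist_special x + dist x y)%N.
Proof.
apply: leq_trans (dist_triangle x _ _).
exact: dist_special_le (proj_special x).
Qed.

Lemma proj_contract x y : square_closed T ->
  (dist x y < dist_special x)%N -> (dist (proj x) (proj y) <= 2 * #|V|)%N.
Proof.
move=> Tcl lt.
apply: (square_closed_contract Tcl (proj_left_min x) (proj_left_min y)).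
  by apply: specialM (proj_special y); apply: specialV; exact: proj_special.
by move: lt; rewrite /dist_special /dist invM invgK !mulA !mulgK.
Qed.

Section QuasiGeodesic.
Hypothesis Tcl : square_closed T.
Variables (k N : nat) (x : nat -> G).
Hypotheses (k_gt0 : (0 < k)%N)
  (x_le : forall i n, (i + n <= N)%N -> (dist (x i) (x (i + n)) <= k * n + k)%N)
  (x_ge : forall i n, (i + n <= N)%N -> (n <= k * dist (x i) (x (i + n)) + k)%N).

(** A block of [q] steps covers at most [r], so beyond distance [r] from [W] its projection moves at
    most [D]; the [+ 1] keeps [D] positive. As [q = 2 * k * D], projections advance at rate
    [1/(2k)], half the least rate [1/k] of the quasi-geodesic. *)
Local Notation D := (2 * #|V| + 1)%N.
Local Notation q := (2 * k * D)%N.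
Local Notation r := (k * q + k)%N.

Lemma proj_far l n : (l + n <= N)%N ->
  (forall m, (m <= n)%N -> (r < dist_special (x (l + m)))%N) ->
  (dist (proj (x l)) (proj (x (l + n))) <= D * (n %/ q).+1)%N.
Proof.
have q_gt0 : (0 < q)%N by lia.
elim/ltn_ind: n l => n IHn l lnN far.
have step m : (m <= q)%N -> (m <= n)%N -> (dist (proj (x l)) (proj (x (l + m))) <= D)%N.
  move=> mq mn; apply: leq_trans (leq_addr _ _).
  apply: proj_contract => //; have := far 0%N isT; rewrite addn0.
  apply: leq_ltn_trans; apply: leq_trans (x_le _) _; first by lia.
  by rewrite leq_add2r leq_mul2l mq orbT.
have [nq|qn] := leqP n q.
  by apply: leq_trans (step n nq (leqnn n)) _; rewrite leq_pmulr.
apply: leq_trans (dist_triangle (proj (x (l + q))) _ _) _.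
have e : n = (q + (n - q))%N by rewrite subnKC // ltnW.
have -> : (D * (n %/ q).+1 = D + D * ((n - q) %/ q).+1)%N.
  by rewrite {1}e divnDl ?divnn ?q_gt0 // add1n mulnS.
apply: leq_add; first by apply: step; rewrite ?(ltnW qn).
have -> : (l + n = l + q + (n - q))%N by rewrite {1}e addnA.
apply: IHn; [by lia|by lia|move=> m mn].
by rewrite -addnA; apply: far; lia.
Qed.

Lemma last_le (P : nat -> Prop) n : P 0%N -> ~ P n ->
  exists2 i, (i < n)%N & P i /\ forall m, (i < m <= n)%N -> ~ P m.
Proof.
move=> P0; elim: n => [//|n IHn] nPn; case: (pselect (P n)) => [Pn|/IHn].
  by exists n => //; split=> // m mn; have -> : m = n.+1 by lia.
move=> [i lt_in [Pi far]]; exists i; [by lia|split=> // m].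
have [->//|mn lt] := eqVneq m n.+1; apply: far; lia.
Qed.

Lemma first_ge (P : nat -> Prop) n p : P (n + p)%N -> ~ P n ->
  exists2 j, (n < j <= n + p)%N & P j /\ forall m, (n <= m < j)%N -> ~ P m.
Proof.
elim: p n => [|p IHp] n Pn nPn; first by rewrite addn0 in Pn.
case: (pselect (P n.+1)) => [P1|nP1].
  exists n.+1; [by lia|split=> // m mn].
  by have -> : m = n by lia.
case: (IHp n.+1) => // [|j lt [Pj far]]; first by rewrite addSnnS.
exists j; [by lia|split=> // m].
have [->//|mn lt'] := eqVneq m n; apply: far; lia.
Qed.

Definition morse_bound : nat :=
  (r + k * (2 * k * (2 * r + 8 * k + D + 1) + 2) + k)%N.

(** Consider the maximal excursion beyond [r] around [m]. Its projection moves by about [n/(2k)] at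
    most, whereas its ends, both near [W], are about [n/k] apart or more; so [n] is bounded. *)
Lemma dist_special_morse : (dist_special (x 0) <= k)%N ->
  (dist_special (x N) <= k)%N ->
  forall m, (m <= N)%N -> (dist_special (x m) <= morse_bound)%N.
Proof.
move=> d0 dN m mN; pose P i := (dist_special (x i) <= r)%N.
case: (pselect (P m)) => [|nPm]; first by rewrite /P /morse_bound; lia.
have [i im [Pi fari]] : exists2 i, (i < m)%N & P i /\ forall l, (i < l <= m)%N -> ~ P l.
  by apply: last_le => //; rewrite /P; lia.
have [j mj [Pj farj]] : exists2 j, (m < j <= m + (N - m))%N &
    P j /\ forall l, (m <= l < j)%N -> ~ P l.
  by apply: first_ge => //; rewrite /P subnKC //; lia.
pose n := (j - i.+2)%N.
have ej : j = (i.+1 + n).+1 by rewrite /n; lia.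
have far l : (l <= n)%N -> (r < dist_special (x (i.+1 + l)))%N.
  move=> ln; rewrite ltnNge; apply/negP.
  by case: (leqP (i.+1 + l) m) => lm; [apply: fari|apply: farj]; lia.
have jN : (j <= N)%N by lia.
have := proj_far (l := i.+1) (n := n) _ far.
move=> /(_ _)/wrap[|dp]; first lia.
have di : (dist (x i) (x i.+1) <= 2 * k)%N.
  by have := x_le (i := i) (n := 1); rewrite addn1; lia.
have dj : (dist (x (i.+1 + n)) (x j) <= 2 * k)%N.
  by have := x_le (i := i.+1 + n) (n := 1); rewrite addn1 ej; lia.
have si := dist_special_lip (x i) (x i.+1).
have sj := dist_special_lip (x j) (x (i.+1 + n)); rewrite distC in sj.
have t1 := dist_triangle (x i.+1) (x i) (x j).
have t2 := dist_triangle (proj (x i.+1)) (x i.+1) (x j).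
have t3 := dist_triangle (proj (x (i.+1 + n))) (proj (x i.+1)) (x j).
have t4 := dist_triangle (x (i.+1 + n)) (proj (x (i.+1 + n))) (x j).
rewrite [dist (x i.+1) (proj _)]distC -/(dist_special _) in t2.
rewrite -/(dist_special _) in t4.
have xg := x_ge (i := i) (n := (j - i)%N).
rewrite subnKC in xg; last by lia.
have {}xg := xg jN.
have dq : (q * (n %/ q) <= n)%N by rewrite mulnC leq_trunc_div.
have sx := dist_special_lip (x i) (x m).
have xl := x_le (i := i) (n := (m - i)%N); rewrite subnKC in xl; last by lia.
have {}xl := xl mN.
rewrite /P in Pi Pj.
(* Each of the two end steps costs [2 * k] twice, once as a step and once in the distance of its
   inner point to [W]. *)
have dij : (dist (x i) (x j) <= 2 * r + 8 * k + D + D * (n %/ q))%N.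
  rewrite mulnS in dp; lia.
(* Since [q = 2 * k * D], the term [k * D * (n %/ q)] is at most half of [n] and is absorbed. *)
have nb : (n <= 2 * k * (2 * r + 8 * k + D + 1))%N.
  have : (k * dist (x i) (x j) <= k * (2 * r + 8 * k + D + D * (n %/ q)))%N.
    by rewrite leq_mul2l dij orbT.
  have e : (j - i = n + 2)%N by lia.
  rewrite e in xg.
  move: dq; set z := (n %/ q)%N; set B := (2 * r + 8 * k + D)%N.
  have -> : (q * z = 2 * (k * (D * z)))%N by rewrite !mulnA.
  have -> : (2 * k * (B + 1) = 2 * (k * B) + 2 * k)%N by rewrite mulnDr muln1 mulnA.
  by rewrite mulnDr; lia.
have : (k * (m - i) <= k * (2 * k * (2 * r + 8 * k + D + 1) + 2))%N.
  by rewrite leq_mul2l; apply/orP; right; lia.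
rewrite /morse_bound; lia.
Qed.

End QuasiGeodesic.
End Projection.

(** * Intersections of conjugates *)

Lemma rwordV g : perm_eq (rword g^-1) (rword g).
Proof.
have e := rwordK g; have a : reduced (rev (rword g)).
  by apply: reduced_len; rewrite wprod_rev lenV size_rev rwordK.
apply: perm_trans (_ : perm_eq (rev (rword g)) _); last by rewrite perm_rev.
by apply: reduced_perm => //; rewrite ?reduced_rword // wprod_rev !rwordK.
Qed.

Lemma all_adj_rwordV s g : all (adj s) (rword g^-1) = all (adj s) (rword g).
Proof. exact/perm_all/rwordV. Qed.

Lemma gen_commute s g : all (adj s) (rword g) -> gen s * g = g * gen s.
Proof. by move/wprod_comm; rewrite rwordK. Qed.

Lemma finite_ball n : finite_set [set g : G | (len g <= n)%N].
Proof.
apply: (@sub_finite_set _ _ [set wprod b | b in [set: n.-bseq V]]).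
  by move=> g /= gn; exists (Bseq gn) => //=; rewrite rwordK.
exact/finite_image/finite_finset.
Qed.

Lemma special_infinite (U : set V) : ~ finite_set (@special_subgroup V adj U) ->
  exists a c, [/\ U a, U c, a != c & ~~ adj a c].
Proof.
move=> inf; apply: contrapT => nac; apply: inf.
apply: sub_finite_set (finite_ball #|V|) => g /specialP[w [aw wU <-]] /=.
rewrite len_reduced // leqNgt; apply/negP => /(nonadjacent_pair aw)[a [c [aW cW ac n]]].
by apply: nac; exists a, c; split=> //; apply: wU.
Qed.

Lemma special_sub (T U : set V) : (forall s, T s -> U s) ->
  forall g, @special_subgroup V adj T g -> @special_subgroup V adj U g.
Proof. by move=> TU g /specialP[w [aw wT e]]; apply/specialP; exists w; split=> // s /wT/TU. Qed.

Section Conjugates.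
Variable T : set V.
Local Notation W := (@special_subgroup V adj T).

Lemma right_min_len h t : left_min T h^-1 -> W t -> len (h * t) = (len h + len t)%N.
Proof.
move=> hmin Wt; rewrite -lenV invM (left_min_len hmin) ?lenV 1?addnC //.
exact: specialV.
Qed.

(** In [gen s * h = h * t] the lengths on the right add up, so [s] is no descent of [h]; being one
    of the product, it passes through [h] and is a descent of [t]. *)
Lemma right_min_conj_gen h s : left_min T h^-1 -> W (h^-1 * gen s * h) ->
  T s /\ all (adj s) (rword h).
Proof.
move=> hmin; set t := _ * h => Wt.
have e : gen s * h = h * t by rewrite /t -!mulA mulVKg.
have l := right_min_len hmin Wt.
have nhs : ~~ descent h s by apply/negP => /len_down; rewrite e l; lia.
have : descent (h * t) s by rewrite -e descent_gen_self.
case/(descent_mulg l) => [hs|[sh ts]]; first by rewrite hs in nhs.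
by split=> //; apply: special_descent Wt ts.
Qed.

Lemma double_coset_min (U : set V) g : exists u h t,
  [/\ @special_subgroup V adj U u, W t, g = u * h * t,
      left_min U h & left_min T h^-1].
Proof.
elim/ltn_ind: {g}(len g) {-2}g (erefl (len g)) => n IHn g lg.
case: (pselect (exists2 s, U s & descent g s)) => [[s Us gs]|nU].
  have [|u [h [t [Wu Wt e hU hT]]]] := IHn _ _ (gen s * g) erefl.
    by have := len_down gs; lia.
  exists (gen s * u), h, t; split=> //; last by rewrite -!mulA [u * _]mulA -e genKl.
  by apply: specialM => //; exact: special_gen.
case: (pselect (exists2 s, T s & descent g^-1 s)) => [[s Ts gs]|nT].
  have lgs : len (g * gen s) = len (gen s * g^-1) by rewrite -lenV invM gen_inv.
  have [|u [h [t [Wu Wt e hU hT]]]] := IHn _ _ (g * gen s) erefl.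
    by have := len_down gs; rewrite lenV lgs; lia.
  exists u, h, (t * gen s); split=> //; last by rewrite mulA -e -mulA genK mulw1.
  by apply: specialM => //; exact: special_gen.
exists 1, g, 1; split; rewrite ?mul1w ?mulw1 //; try exact: special1.
  by move=> s Us; apply/negP => gs; apply: nU; exists s.
by move=> s Ts; apply/negP => gs; apply: nT; exists s.
Qed.

(** Write [g = u * h * t] with [h] minimal in its double coset. Up to conjugation by [u], the
    intersection is generated by the letters in both [U] and [T] that commute with all of [h]. *)
Lemma special_cap_conj (U : set V) g : exists u U', forall x,
  (@special_subgroup V adj U x /\ W (g^-1 * x * g)) <->
  @special_subgroup V adj U' (u^-1 * x * u).
Proof.
have [u [h [t [Wu Wt -> hU hT]]]] := double_coset_min U g.
pose U' : set V := [set s | [/\ U s, T s & all (adj s) (rword h)]].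
exists u, U' => x.
have Wh y : W (h^-1 * y * h) <-> W ((h * t)^-1 * y * (h * t)).
  have e : (h * t)^-1 * y * (h * t) = t^-1 * (h^-1 * y * h) * t.
    by rewrite invM !mulA.
  split=> Wy; first by rewrite e; apply: specialM => //; apply: specialM => //; exact: specialV.
  have -> : h^-1 * y * h = t * ((h * t)^-1 * y * (h * t)) * t^-1.
    by rewrite e !mulA mulgV mul1w mulgK.
  by apply: specialM (specialV Wt); apply: specialM.
have e : (u * h * t)^-1 * x * (u * h * t) = (h * t)^-1 * (u^-1 * x * u) * (h * t).
  by rewrite !invM !mulA.
(* A first letter [r] is a descent of [h * z] but not of [h]; so it commutes with [h], is a descent
   of [z] in [W], and lies in [U']. *)
have key y : @special_subgroup V adj U y -> W (h^-1 * y * h) -> @special_subgroup V adj U' y.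
  move: y; apply: special_ind => [_|r y Ur Wy nr IHy Wr]; first exact: special1.
  set z := _ * h in Wr.
  have ez : gen r * (y * h) = h * z by rewrite /z !mulA mulgV mul1w.
  have l := right_min_len hT Wr.
  have : descent (h * z) r by rewrite -ez descent_gen_self (left_min_descent hU Wy Ur).
  case/(descent_mulg l) => [hr|[rh zr]]; first by have := hU r Ur; rewrite hr.
  have Tr := special_descent Wr zr.
  have U'r : @special_subgroup V adj U' (gen r) by apply: special_gen.
  apply: specialM => //; apply: IHy.
  have -> : h^-1 * y * h = gen r * z.
    by rewrite -mulA -[y * h](genKl r) ez [gen r * _]mulA (gen_commute rh) -mulA mulKg.
  by apply: specialM => //; apply: special_gen.
rewrite e; split=> [[Wx /Wh]|Wx].
  by apply: key; apply: specialM => //; apply: specialM => //; exact: specialV.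
set y := u^-1 * x * u in Wx *.
have ex : x = u * y * u^-1 by rewrite /y !mulA mulgV mul1w mulgK.
have Uy : @special_subgroup V adj U y by apply: special_sub Wx => s [].
split; first by rewrite ex; apply: specialM (specialV Wu); apply: specialM.
apply/Wh; have -> : h^-1 * y * h = y.
  suff: y * h = h * y by move=> yh; rewrite -mulA yh mulKg.
  move: (y) Wx; apply: special_ind => [|r z [_ _ rh] _ _ IHz]; first by rewrite mul1w mulw1.
  by rewrite -mulA IHz !mulA (gen_commute rh).
by apply: special_sub Wx => s [].
Qed.

Lemma special_bigcap_conj (g : G) (gs : seq G) : exists k U, forall x,
  (forall y, y \in g :: gs -> W (y^-1 * x * y)) <->
  @special_subgroup V adj U (k^-1 * x * k).
Proof.
elim: gs => [|g' gs [k [U IH]]].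
  exists g, T => x; split=> [|Wx y]; first by apply; rewrite mem_head.
  by rewrite inE => /eqP->.
have [u [U' eU']] := special_cap_conj U (k^-1 * g').
exists (k * u), U' => x.
have e1 : (k * u)^-1 * x * (k * u) = u^-1 * (k^-1 * x * k) * u.
  by rewrite invM !mulA.
have e2 : (k^-1 * g')^-1 * (k^-1 * x * k) * (k^-1 * g') = g'^-1 * x * g'.
  by rewrite invM invgK !mulA !mulgK.
rewrite e1 -eU' e2 -IH; split=> [Wx|[Wx Wg'] y].
  split=> [y|]; last by apply: Wx; rewrite !inE eqxx orbT.
  by rewrite inE => yg; apply: Wx; rewrite !inE orbCA yg orbT.
rewrite !inE orbCA => /orP[/eqP->//|yg].
by apply: Wx; rewrite inE.
Qed.

(** Pigeonhole: if the intersection is infinite, each coset has, up to a common translation, a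
    representative with at most [#|V|] letters. The bound counts the words of that length. *)
Lemma square_closed_height (g0 : G) : square_closed T ->
  height_bound (conj_set g0 W) #|{: #|V|.-bseq V}|.
Proof.
set N := #|_| => Tcl g dg; apply: contrapT => inf.
pose gg i := g i * g0.
have conjP i x : conj_set (g i) (conj_set g0 W) x <-> W ((gg i)^-1 * x * gg i).
  rewrite /gg; split.
    move=> [_ [w Ww <-] <-]; rewrite invM !mulA.
    by rewrite !mulgVK mulVg mul1w.
  move=> Wx; exists (g0 * ((gg i)^-1 * x * gg i) * g0^-1); first by exists ((gg i)^-1 * x * gg i).
  by rewrite /gg invM !mulA !mulgK mulgV mul1w.
have [k [U kU]] := special_bigcap_conj (gg ord0) [seq gg i | i <- enum 'I_N.+1].
have {}kU x : (forall i, W ((gg i)^-1 * x * gg i)) <-> @special_subgroup V adj U (k^-1 * x * k).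
  rewrite -kU; split=> Wx i; last by apply: Wx; rewrite inE map_f ?orbT // mem_enum.
  by rewrite inE => /orP[/eqP->|/mapP[j _ ->]].
have [a [c [Ua Uc ac nac]]] : exists a c, [/\ U a, U c, a != c & ~~ adj a c].
  apply: special_infinite => fin; apply: inf.
  apply: sub_finite_set (finite_image (fun y => k * y * k^-1) fin) => x /= xP.
  exists (k^-1 * x * k); last by rewrite !mulA mulgV mul1w mulgK.
  by apply/kU => i; apply/conjP; apply: xP.
(* Projecting the inverse makes [h i] the shortest element of the left coset of [k^-1 * gg i]. *)
pose w i := proj T (k^-1 * gg i)^-1; pose h i := k^-1 * gg i * w i.
have Ww i : W (w i) by apply: proj_special.
have hmin i : left_min T (h i)^-1.
  by rewrite /h invM; apply: proj_left_min.
have hs i s : U s -> T s /\ all (adj s) (rword (h i)).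
  move=> Us; apply: right_min_conj_gen => //.
  have /kU/(_ i) Wi : @special_subgroup V adj U (k^-1 * (k * gen s * k^-1) * k).
    by rewrite !mulA mulVg mul1w mulgVK; apply: special_gen.
  have -> : (h i)^-1 * gen s * h i =
      (w i)^-1 * ((gg i)^-1 * (k * gen s * k^-1) * gg i) * w i.
    by rewrite /h !invM invgK !mulA.
  by apply: specialM => //; apply: specialM => //; exact: specialV.
have hV i : (size (rword (h i)) <= #|V|)%N.
  rewrite -/(len (h i)) -lenV.
  have [Ta ah] := hs i a Ua; have [Tc ch] := hs i c Uc.
  by apply: (square_closed_len Tcl Ta Tc ac nac (hmin i)); rewrite all_adj_rwordV.
have /leq_card : injective (fun i => Bseq (hV i)).
  move=> i j /(congr1 val) /= e; apply/eqP/negPn/negP => ij; apply: (dg i j ij).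
  have {}e : h i = h j by rewrite -[LHS]rwordK e rwordK.
  have sub i' j' : h i' = h j' ->
      left_coset (g i') (conj_set g0 W) `<=` left_coset (g j') (conj_set g0 W).
    move=> e' _ [_ [y Wy <-] <-]; exists (g0 * (w j' * (w i')^-1 * y) * g0^-1).
      exists (w j' * (w i')^-1 * y) => //; apply: specialM => //.
      by apply: specialM => //; exact: specialV.
    have eg : gg i' = gg j' * w j' * (w i')^-1.
      have <- : k * h i' * (w i')^-1 = gg i' by rewrite /h !mulA mulgV mul1w mulgK.
      by rewrite e' /h !mulA mulgV mul1w.
    by move: eg; rewrite /gg !mulA => ->.
  by apply/seteqP; split; apply: sub.
by rewrite card_ord ltnn.
Qed.

End Conjugates.

(** * Flats *)

Fixpoint alt (s t : V) (n : nat) : seq V :=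
  if n is n'.+1 then s :: alt t s n' else [::].

Lemma alt_cat s t m n : alt s t (m + n) =
  alt s t m ++ (if odd m then alt t s n else alt s t n).
Proof. by elim: m s t => [//|m IHm] s t; rewrite addSn /= IHm; case: (odd m). Qed.

Lemma mem_alt s t n u : u \in alt s t n -> u = s \/ u = t.
Proof.
elim: n s t => [//|n IHn] s t; rewrite inE => /orP[/eqP->|/IHn[]]; by [left|right].
Qed.

Lemma wprod_comm_cat u v : (forall s t, s \in u -> t \in v -> adj s t) ->
  wprod u * wprod v = wprod v * wprod u.
Proof.
elim: u => [|s u IHu] uv; first by rewrite mul1w mulw1.
rewrite /= -mulA IHu => [|r t ru tv]; last by apply: uv; rewrite // inE ru orbT.
by rewrite !mulA wprod_comm //; apply/allP => t tv; apply: uv; rewrite // mem_head.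
Qed.

Lemma reduced_alt s t n : s != t -> ~~ adj s t ->
  reduced (alt s t n) /\ forall u, descent (wprod (alt s t n)) u -> u = s.
Proof.
elim: n s t => [|n IHn] s t st nst; first by split=> // u; rewrite desc1.
have [] := IHn t s; [by rewrite eq_sym|by rewrite adj_sym|move=> a d].
have nd : ~~ descent (wprod (alt t s n)) s by apply: contraNN st => /d ->.
split; first exact: reduced_cons.
move=> u /=; have [-> //|us] := eqVneq u s.
case: (boolP (adj s u)) => su; last by rewrite descent_gen_nadj.
by rewrite descent_gen_adj // => /d e; rewrite -e su in nst.
Qed.

Lemma len_alt s t n : s != t -> ~~ adj s t -> len (wprod (alt s t n)) = n.
Proof.
move=> st nst; rewrite len_reduced; last by case: (reduced_alt n st nst).
by elim: n (s) (t) => //= n IHn s' t'; rewrite IHn.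
Qed.

Lemma dist_alt s t m n : s != t -> ~~ adj s t ->
  dist (wprod (alt s t m)) (wprod (alt s t n)) = (m - n + (n - m))%N.
Proof.
move=> st nst; wlog mn : m n / (m <= n)%N => [IH|].
  by case/orP: (leq_total m n) => /IH // e; rewrite distC e addnC.
rewrite -(subnKC mn) /dist alt_cat wprod_cat mulKg.
have -> : (m - (m + (n - m)) + (m + (n - m) - m) = n - m)%N by lia.
by case: (odd m); rewrite len_alt // ?[t == s]eq_sym // adj_sym.
Qed.

Section Square.
Variables (T : set V) (a b c d : V).
Hypotheses (Ta : T a) (Tc : T c) (nTb : ~ T b) (ac : a != c) (nac : ~~ adj a c)
  (bd : b != d) (nbd : ~~ adj b d) (ab : adj a b) (bc : adj b c) (cd : adj c d)
  (da : adj d a).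
Local Notation W := (@special_subgroup V adj T).

Definition flat i j : G := wprod (alt b d i) * wprod (alt a c j).

Lemma adj_ac_bd s t : s \in [:: a; c] -> t \in [:: b; d] -> adj s t.
Proof.
by rewrite !inE => /orP[]/eqP-> /orP[]/eqP->; rewrite // adj_sym.
Qed.

Lemma alt_comm i j : wprod (alt b d i) * wprod (alt a c j) = wprod (alt a c j) * wprod (alt b d i).
Proof.
apply: wprod_comm_cat => s t /mem_alt sbd /mem_alt tac; rewrite adj_sym.
by apply: adj_ac_bd; rewrite !inE; [case: tac|case: sbd] => ->; rewrite eqxx ?orbT.
Qed.

Lemma alt_special s t i (U : set V) : U s -> U t -> @special_subgroup V adj U (wprod (alt s t i)).
Proof. by move=> Us Ut; apply: special_wprod => r /mem_alt[]->. Qed.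

(** The two dihedral groups commute, so the quotient is [B * A]; since [A] has no descent among [b],
    [d], the lengths add up. *)
Lemma dist_flat i j i' j' :
  dist (flat i j) (flat i' j') = (i - i' + (i' - i) + (j - j' + (j' - j)))%N.
Proof.
pose B := (wprod (alt b d i))^-1 * wprod (alt b d i').
pose A := (wprod (alt a c j))^-1 * wprod (alt a c j').
have WB : @special_subgroup V adj [set s | s \in [:: b; d]] B.
  apply: specialM; first apply: specialV.
    by apply: alt_special; rewrite /= !inE eqxx ?orbT.
  by apply: alt_special; rewrite /= !inE eqxx ?orbT.
have WA : @special_subgroup V adj [set s | s \in [:: a; c]] A.
  apply: specialM; first apply: specialV.
    by apply: alt_special; rewrite /= !inE eqxx ?orbT.
  by apply: alt_special; rewrite /= !inE eqxx ?orbT.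
have Amin : left_min [set s | s \in [:: b; d]] A.
  move=> s /= sbd; apply/negP => /(special_descent WA)/= sac.
  by have := adj_ac_bd sac sbd; rewrite adj_irr.
have e : (flat i j)^-1 * flat i' j' = B * A.
  have cB : commute (wprod (alt a c j)) B.
    by apply: commuteM; [apply: commuteV|]; apply: commute_sym; apply: alt_comm.
  have {}cB : B * (wprod (alt a c j))^-1 = (wprod (alt a c j))^-1 * B.
    by apply: commuteV; apply: commute_sym.
  by rewrite /A [RHS]mulA cB /flat invM /B !mulA.
by rewrite /dist e (left_min_len Amin WB) -/(dist _ _) dist_alt // -/(dist _ _) dist_alt.
Qed.

(** Out along the [b], [d] ray, across, and back: both ends lie in [W], while the corner [path n n]
    is far from it. *)
Definition path n k : G := flat (detour_x n k) (detour_y n k).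

Lemma path_dist n k l : (k <= 3 * n)%N -> (l <= 3 * n)%N ->
  (dist (path n k) (path n l) <= k - l + (l - k))%N /\
  (k - l + (l - k) <= 3 * dist (path n k) (path n l))%N.
Proof. by move=> kn ln; rewrite dist_flat; exact: detour_dist. Qed.

Lemma path_start n : W (path n 0).
Proof.
have -> : path n 0 = flat 0 0 by rewrite /path /detour_x /detour_y; congr flat; lia.
by rewrite /flat mul1w; exact: special1.
Qed.

Lemma path_end n : W (path n (3 * n)).
Proof.
have -> : path n (3 * n) = flat 0 n by rewrite /path /detour_x /detour_y; congr flat; lia.
by rewrite /flat mul1w; exact: alt_special.
Qed.

Lemma path_far n t : W t -> (n <= dist t (path n n))%N.
Proof.
move=> Wt; have -> : path n n = wprod (alt b d n).
  rewrite -[RHS]mulw1 -[1]/(wprod (alt a c 0)) -/(flat n 0).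
  rewrite /path /detour_x /detour_y; congr flat; lia.
have bmin : left_min T (wprod (alt b d n)).
  move=> s Ts; apply/negP; case: (reduced_alt n bd nbd) => _ /[apply] e.
  by apply: nTb; rewrite -e.
rewrite /dist (left_min_len bmin (specialV Wt)) len_alt //; exact: leq_addl.
Qed.

Lemma square_not_height (g0 : G) n : ~ height_bound (conj_set g0 W) n.
Proof.
(* Even length gives powers of [bd], so that after cancelling a common prefix the word starts with
   [b] again; this descent outside [T] separates the cosets. *)
pose g (i : 'I_n.+1) := g0 * wprod (alt b d (2 * i)) * g0^-1.
move=> /(_ g) fin.
have /fin {}fin : forall i j, i != j ->
    left_coset (g i) (conj_set g0 W) <> left_coset (g j) (conj_set g0 W).
  move=> i j ij e; wlog lt : i j ij e / (i < j)%N => [IH|].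
    case: (ltngtP i j) => [|ji|/val_inj/eqP]; [exact: IH| |exact/negP].
    by apply: (IH j i) => //; rewrite eq_sym.
  have : left_coset (g j) (conj_set g0 W) (g j).
    by exists 1; rewrite ?mulw1 //; exists 1; [exact: special1|rewrite mulw1 mulgV].
  rewrite -e => -[_ [w Ww <-]]; rewrite /g !mulA mulgVK => /mulIg.
  rewrite -!mulA => /mulgI ew; apply: nTb; apply: (special_descent Ww).
  have ji : (2 * j = 2 * i + (2 * (j - i)).-1.+1)%N by lia.
  move: ew; rewrite ji alt_cat wprod_cat oddM /= => /mulgI ->.
  rewrite descent_gen_self; case: (reduced_alt (2 * (j - i)).-1 (s := d) (t := b)).
  - by rewrite eq_sym.
  - by rewrite adj_sym.
  by move=> _ dd; apply/negP => /dd/eqP; rewrite (negbTE bd).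
(* The intersection, conjugated back by [g0], contains an alternating word in [a], [c] of every
   length. *)
apply: infinite_nat.
apply: sub_finite_set (finite_image (fun x => len (g0^-1 * x * g0)) fin) => k _ /=.
exists (g0 * wprod (alt a c k) * g0^-1); last by rewrite !mulA mulVg mul1w mulgVK len_alt.
move=> i _; exists (g0 * wprod (alt a c k) * g0^-1).
  by exists (wprod (alt a c k)) => //; apply: alt_special.
rewrite /g !invM invgK !mulA !mulgVK -[g0 * _ * _]mulA alt_comm.
by rewrite !mulA mulgK.
Qed.

End Square.

(** * Quasi-geodesics *)

Section Quasiconvex.
Variables (A : set G) (A_fin : finite_set A) (A_gen : generated A = setT).
Variable g0 : G.

(** Each length bounds the other linearly, with the largest length of a generator as constant.
    Conjugation by [g0] at the same time moves the parabolic subgroup to [W]. *)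
Lemma word_length_conj_bound : exists2 L, (0 < L)%N & forall z,
  (len (g0^-1 * z * g0)%g <= L * word_length A z)%N /\
  (word_length A z <= L * len (g0^-1 * z * g0)%g)%N.
Proof.
have /finite_seqP[s eA] := A_fin.
pose L1 := \max_(a <- s) len (g0^-1 * a * g0)%g.
pose L2 := \max_(t : V) word_length A (g0 * gen t * g0^-1)%g.
exists (maxn L1 L2).+1 => // z; split.
  apply: (@word_length_dominates _ _ A_gen (fun z => len (g0^-1 * z * g0))).
  - by rewrite mulw1 mulVg len1.
  - move=> g h; have -> : g0^-1 * (g * h) * g0 = (g0^-1 * g * g0) * (g0^-1 * h * g0).
      by rewrite !mulA mulgK.
    exact: lenM.
  - move=> a Aa; have la : (len (g0^-1 * a * g0)%g <= (maxn L1 L2).+1)%N.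
      apply: leq_trans (leqnSn _); rewrite leq_max; apply/orP; left.
      by apply: leq_bigmax_seq; move: Aa; rewrite // eA.
    by split=> //; rewrite -lenV !invM !invgK mulA.
have -> : z = g0 * (g0^-1 * z * g0) * g0^-1 by rewrite !mulA mulgV mul1w mulgK.
set y := g0^-1 * z * g0.
have -> : g0^-1 * (g0 * y * g0^-1) * g0 = y by rewrite !mulA mulVg mul1w mulgVK.
rewrite -(rwordK y) (len_reduced (reduced_rword y)).
elim: (rword y) => [|t w IHw]; first by rewrite mulw1 mulgV word_length1.
have -> : g0 * wprod (t :: w) * g0^-1 = (g0 * gen t * g0^-1) * (g0 * wprod w * g0^-1).
  by rewrite /= !mulA mulgVK.
rewrite [size _]/= mulnS; apply: leq_trans (word_lengthM A_gen _ _) (leq_add _ IHw).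
apply: leq_trans (leqnSn _); rewrite leq_max; apply/orP; right.
exact: (leq_bigmax t).
Qed.

Variables (R : realType) (T : set V).
Local Notation W := (@special_subgroup V adj T).
Local Notation vdist := (vertex_dist R A).
Local Open Scope ring_scope.

Lemma qgeod_domain_sample (I : set R) a b n : qgeod_domain I -> I a -> I b ->
  a <= a + n%:R <= b -> I (a + n%:R).
Proof.
have conv (i : interval R) x y z : [set` i] x -> [set` i] y -> x <= z <= y -> [set` i] z.
  rewrite /=; case: i => [[[] l|[]] [[] u|[]]]; rewrite !in_itv /=; lra.
move=> [i [->|->]]; first exact: conv.
move=> [ia [k _ ka]] [ib _] anb; split; first exact: conv anb.
by exists (k + n%:Z) => //; rewrite intrD ka.
Qed.

(** The map is sampled at [a + i]. Every time, in particular [b], is less than 1 after a sample,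
    which the tolerance at the ends in [dist_special_morse] allows for. *)
Lemma quasi_geodesic_morse k : square_closed T -> exists M, 
  forall (I : set R) (F : R -> G) (a b : R), qgeod_domain I -> has_endpoints I a b ->
  (forall s t, I s -> I t -> (dist (F s) (F t))%:R <= k%:R * `|s - t| + k%:R) ->
  (forall s t, I s -> I t -> `|s - t| <= k%:R * (dist (F s) (F t))%:R + k%:R) ->
  W (F a) -> W (F b) -> forall t, I t -> exists2 p, W p & (dist p (F t) <= M)%N.
Proof.
(* A time difference of at most 1 moves a point by at most [2 * k]; the successor makes [k2]
   positive. *)
move=> Tcl; pose k2 := (2 * k).+1.
exists (morse_bound k2 + k2)%N => I F a b Idom [Ia Ib ab] le ge Wa Wb t It.
pose x i := F (a + i%:R); pose N := Num.truncn (b - a).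
have ab0 : 0 <= b - a by have /andP[] := ab b Ib; lra.
have Ix i : (i <= N)%N -> I (a + i%:R).
  rewrite truncn_ge_nat // => iN; apply: qgeod_domain_sample Idom Ia Ib _.
  by rewrite ler_wpDr ?ler0n //=; lra.
have near u v : I u -> I v -> `|u - v| <= 1 -> (dist (F u) (F v) <= k2)%N.
  move=> Iu Iv uv; rewrite -(ler_nat R); apply: le_trans (le u v Iu Iv) _.
  have : k%:R * `|u - v| <= k%:R * 1 by rewrite ler_wpM2l.
  by rewrite /k2 -natr1 natrM; have : 0 <= k%:R :> R by []; lra.
have dW g : W g -> dist_special T g = 0%N.
  by move=> /(dist_special_le g); rewrite /dist mulVg len1 leqn0 => /eqP.
have d0 : (dist_special T (x 0%N) <= k2)%N by rewrite /x addr0 dW.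
have dN : (dist_special T (x N) <= k2)%N.
  apply: leq_trans (dist_special_lip T (F b) _) _; rewrite dW // add0n.
  apply: near => //; first exact: Ix.
  have := truncn_itv ab0; rewrite -natr1 -/N ler_norml; lra.
have abs i n : `|a + i%:R - (a + (i + n)%:R)| = n%:R :> R.
  by rewrite natrD opprD addrACA subrr add0r opprD addrA subrr sub0r normrN normr_nat.
have x_le i n : (i + n <= N)%N -> (dist (x i) (x (i + n)%N) <= k2 * n + k2)%N.
  move=> inN; apply: (@leq_trans (k * n + k)%N); last by rewrite /k2; lia.
  rewrite -(ler_nat R) natrD natrM -(abs i n); apply: le; apply: Ix => //.
  exact: leq_trans (leq_addr _ _) inN.
have x_ge i n : (i + n <= N)%N -> (n <= k2 * dist (x i) (x (i + n)%N) + k2)%N.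
  move=> inN; apply: (@leq_trans (k * dist (x i) (x (i + n)%N) + k)%N); last by rewrite /k2; lia.
  rewrite -(ler_nat R) natrD natrM -(abs i n); apply: ge; apply: Ix => //.
  exact: leq_trans (leq_addr _ _) inN.
have /andP[at_ tb] := ab t It.
pose m := Num.truncn (t - a).
have mN : (m <= N)%N by apply: le_truncn; lra.
have dm := dist_special_morse Tcl (ltn0Sn _) x_le x_ge d0 dN mN.
exists (proj T (F t)); first exact: proj_special.
apply: leq_trans (dist_special_lip T (x m) _) (leq_add dm _).
apply: near => //; first exact: Ix.
have ta0 : 0 <= t - a by lra.
have := truncn_itv ta0; rewrite -natr1 -/m ler_norml; lra.
Qed.

Lemma square_closed_quasiconvex :
  square_closed T -> strongly_quasiconvex R A (conj_set g0 W).
Proof.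
move=> Tcl K C K1 C0.
have [L L_gt0 bil] := word_length_conj_bound.
have L1 : 1 <= L%:R :> R by rewrite ler1n.
(* [X] dominates the constants [L * K], [K * (C + 2)] and [L * (C + 2)] that arise below; the 2 is
   the error of rounding to vertices. *)
pose X := L%:R * K * (C + 2); pose k := (Num.truncn X).+1.
have LK1 : 1 <= L%:R * K by apply: mulr_ege1.
have X0 : 0 <= X by rewrite mulr_ge0 //; lra.
have Xk : X <= k%:R by have := truncn_itv X0; rewrite /k; lra.
have X1 : L%:R * K <= X by rewrite ler_peMr //; lra.
have X2 : K * (C + 2) <= X by rewrite /X -mulrA ler_peMl // mulr_ge0; lra.
have X3 : L%:R * (C + 2) <= X.
  by rewrite /X [L%:R * K]mulrC -mulrA ler_peMl // mulr_ge0; lra.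
have [M HM] := quasi_geodesic_morse k Tcl.
exists ((L * M)%:R + 2) => I f a b [Idom qg] ends [ha Hha fa] [hb Hhb fb] t It.
pose F s := (g0^-1 * cayley_vertex (f s) * g0)%g.
have dF u v : dist (F u) (F v) =
    len (g0^-1 * ((cayley_vertex (f u))^-1 * cayley_vertex (f v)) * g0)%g.
  by rewrite /dist /F !invM invgK !mulA mulgK.
have WF u h : conj_set g0 W h -> f u = CayleyVertex R A h -> W (F u).
  by move=> [w Ww <-] fu; rewrite /F fu /= !mulA mulVg mul1w mulgVK.
have est u v : I u -> I v ->
    [/\ `|u - v| <= K * vdist (cayley_vertex (f u)) (cayley_vertex (f v)) + K * (C + 2),
        vdist (cayley_vertex (f u)) (cayley_vertex (f v)) <= K * `|u - v| + (C + 2),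
        (dist (F u) (F v))%:R <= L%:R * vdist (cayley_vertex (f u)) (cayley_vertex (f v)) &
        vdist (cayley_vertex (f u)) (cayley_vertex (f v)) <= L%:R * (dist (F u) (F v))%:R].
  move=> Iu Iv; have /andP[lo up] := qg u v Iu Iv.
  have := cayley_dist_near A_gen (f u) (f v); rewrite ler_norml => /andP[n1 n2].
  have K0 : 0 < K by lra.
  split; last 2 first.
  - by rewrite dF -natrM ler_nat; case: (bil ((cayley_vertex (f u))^-1 * cayley_vertex (f v))%g).
  - by rewrite dF -natrM ler_nat; case: (bil ((cayley_vertex (f u))^-1 * cayley_vertex (f v))%g).
  - rewrite -mulrDr -ler_pdivrMl //; lra.
  - lra.
have [||||p Wp pt] := HM I F a b Idom ends _ _ _ _ t It.
- move=> u v Iu Iv; have [_ e2 e3 _] := est u v Iu Iv.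
  apply: le_trans e3 _; apply: (@le_trans _ _ (L%:R * (K * `|u - v| + (C + 2)))).
    by rewrite ler_wpM2l.
  rewrite mulrDr mulrA lerD //; last exact: le_trans Xk.
  by rewrite ler_wpM2r // (le_trans X1).
- move=> u v Iu Iv; have [e1 _ _ e4] := est u v Iu Iv.
  apply: le_trans e1 _; rewrite lerD //; last exact: le_trans Xk.
  apply: (@le_trans _ _ (K * (L%:R * (dist (F u) (F v))%:R))).
    by rewrite ler_wpM2l //; lra.
  by rewrite mulrA [K * _]mulrC ler_wpM2r // (le_trans X1).
- exact: WF Hha fa.
- exact: WF Hhb fb.
exists (g0 * p * g0^-1)%g; first by exists p.
have := cayley_dist_near A_gen (f t) (CayleyVertex R A (g0 * p * g0^-1)%g).
rewrite ler_norml => /andP[_]; rewrite lerBlDl /= => le; apply: le_trans le _.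
rewrite lerD2r /vertex_dist ler_nat.
have [_ le] := bil ((cayley_vertex (f t))^-1 * (g0 * p * g0^-1))%g.
apply: leq_trans le _; rewrite leq_mul2l; apply/orP; right.
apply: leq_trans pt; rewrite distC /dist /F !invM invgK !mulA mulgVK; exact: leqnn.
Qed.

Lemma quasiconvex_square_closed :
  strongly_quasiconvex R A (conj_set g0 W) -> square_closed T.
Proof.
move=> qc a b c d Ta Tc ac nac bd nbd ab bc cd da; apply: contrapT => nTb.
have [L L_gt0 bil] := word_length_conj_bound.
have L1 : 1 <= L%:R :> R by rewrite ler1n.
(* The factor 3 is the distortion of the detour, [L] that of the change of metric; at integer times
   the additive constant is 0. *)
have [|M HM] := qc (3 * L%:R) 0 _ (lexx _); first by lra.
(* The corner is at distance [n] or more from [W], beyond the radius [M] converted by [L]; the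
   absolute value covers negative [M]. *)
pose n := (Num.truncn (L%:R * `|M|)).+1.
pose gamma k := path a b c d n k.
have pd k l := path_dist ac nac bd nbd ab bc cd da (n := n) (k := k) (l := l).
pose I : set R := [set` `[0, (3 * n)%:R]] `&` range (fun z : int => z%:~R).
pose f (t : R) := CayleyVertex R A (g0 * gamma (Num.truncn t) * g0^-1)%g.
have II t : I t -> exists2 k, (k <= 3 * n)%N & t = k%:R.
  move=> [/= + [z _ ez]]; rewrite -ez in_itv /= => /andP[z0 zn].
  case: z z0 zn {ez} => [k|k]; last by rewrite ler0z.
  by rewrite ler_nat => _ kn; exists k.
have In k : (k <= 3 * n)%N -> I k%:R.
  by move=> kn; split; [rewrite /= in_itv /= ler0n ler_nat|exists k%:Z].
have conjE x y : ((g0 * x * g0^-1)^-1 * (g0 * y * g0^-1) = g0 * (x^-1 * y) * g0^-1)%g.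
  by rewrite !invM invgK !mulA mulgVK.
have conjK x : (g0^-1 * (g0 * x * g0^-1) * g0 = x)%g.
  by rewrite !mulA mulVg mul1w mulgVK.
have truncI k : Num.truncn (k%:R : R) = k by rewrite natrK.
have [|||||h Hh dh] := HM I f 0 (3 * n)%:R _ _ _ _ n%:R.
- split; first by exists `[0, (3 * n)%:R]; right.
  move=> _ _ /II[k kn ->] /II[l ln ->].
  have [up lo] := pd k l kn ln; rewrite distC in up lo.
  have [b1 b2] := bil (g0 * ((gamma l)^-1 * gamma k) * g0^-1)%g.
  rewrite conjK in b1 b2.
  rewrite /f /= !truncI /vertex_dist conjE subr0 addr0.
  rewrite normr_natB; apply/andP; split.
    rewrite ler_pdivrMl; last by rewrite mulr_gt0 // ltr0n.
    rewrite -!natrM ler_nat; apply: leq_trans lo _; rewrite -mulnA leq_mul2l /=.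
    exact: b1.
  rewrite -!natrM ler_nat; apply: leq_trans b2 _.
  apply: (@leq_trans (L * (k - l + (l - k)))%N); first by rewrite leq_mul2l up orbT.
  by rewrite leq_mul2r leq_pmull ?orbT.
- split; [exact: (In 0%N)|exact: In|].
  by move=> _ /II[k kn ->]; rewrite ler0n ler_nat.
- exists (g0 * gamma 0%N * g0^-1)%g; last by rewrite /f truncn0.
  by exists (gamma 0%N) => //; apply: path_start.
- exists (g0 * gamma (3 * n)%N * g0^-1)%g; last by rewrite /f truncI.
  by exists (gamma (3 * n)%N) => //; apply: path_end.
- by apply: In; lia.
case: Hh dh => w Ww <-; rewrite /f /= truncI /vertex_dist conjE => le.
have far : (n <= dist w (gamma n))%N by apply: path_far Ww.
have [b1 _] := bil (g0 * (w^-1 * gamma n) * g0^-1)%g.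
rewrite conjK -/(dist _ _) in b1.
have : (n%:R : R) <= L%:R * `|M|.
  apply: (@le_trans _ _ (L * word_length A (g0 * (w^-1 * gamma n) * g0^-1)%g)%N%:R).
    by rewrite ler_nat; apply: leq_trans far _.
  by rewrite natrM ler_wpM2l // (le_trans le) // ler_norm.
have LM0 : 0 <= L%:R * `|M| by rewrite mulr_ge0.
by have := truncn_itv LM0; rewrite /n; lra.
Qed.

End Quasiconvex.

Lemma finite_height_special (T : set V) g :
  finite_height (conj_set g (@special_subgroup V adj T)) <-> square_closed T.
Proof.
rewrite finite_heightP; split=> [[n Hn]|Tcl].
  move=> a b c d Ta Tc ac nac bd nbd ab bc cd da; apply: contrapT => nTb.
  exact: (@square_not_height T a b c d) Hn.
by eexists; apply: square_closed_height.
Qed.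

End Racg.

Theorem proposition4 (R : realType) (V : finType) (adj : rel V)
    (adj_sym : symmetric adj) (adj_irr : irreflexive adj)
    (A : set (racg adj)) (A_fin : finite_set A) (A_gen : generated A = setT)
    (H : set (racg adj)) (H_par : parabolic_subgroup H) :
  strongly_quasiconvex R A H <-> finite_height H.
Proof.
have [T [g ->]] := H_par; rewrite finite_height_special //.
by split; [apply: quasiconvex_square_closed|apply: square_closed_quasiconvex].
Qed.
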